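(* Let $T$ be an algebraic torus over $\mathbb{C}$, let $\Delta$ be a smooth fan in $V=\hom_{\mathbb{Z}}(X^*(T),\mathbb{R})$, and let $\mathcal{K}_{\Gamma,\phi}\subset T$ be a layer which has property $(E)$ with respect to $\Delta$. Let $\overline{\mathcal{K}}_{\Gamma,\phi}$ be the closure of $\mathcal{K}_{\Gamma,\phi}$ in the toric variety $K_\Delta$. Then: 1) $\overline{\mathcal{K}}_{\Gamma,\phi}$ is a smooth $H$-variety whose fan is $\Delta_H$. 2) Let $\mathcal{O}$ be a $T$-orbit in $K_\Delta$ and let $C_{\mathcal{O}}\in\Delta$ be the corresponding cone. Then: (a) if $C_{\mathcal{O}}$ is not contained in $V_H$, then $\mathcal{O}\cap\overline{\mathcal{K}}_{\Gamma,\phi}=\emptyset$; (b) if $C_{\mathcal{O}}\subset V_H$, then $\mathcal{O}\cap\overline{\mathcal{K}}_{\Gamma,\phi}$ is the $H$-orbit in $\overline{\mathcal{K}}_{\Gamma,\phi}$ corresponding to $C_{\mathcal{O}}\in\Delta_H$.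
   Context: $X^*(T)$ is the character lattice of $T$, $X_*(T)=\hom_{\mathbb{Z}}(X^*(T),\mathbb{Z})$ the lattice of one-parameter subgroups, and $V=\hom_{\mathbb{Z}}(X^*(T),\mathbb{R})=X_*(T)\otimes_{\mathbb{Z}}\mathbb{R}$. Elements $\chi\in X^*(T)$ are linear functions on $V$; the corresponding character $T\to\mathbb{C}^*$ is denoted $x_\chi$. Layer: given a split direct summand $\Gamma\subset X^*(T)$ and a homomorphism $\phi:\Gamma\to\mathbb{C}^*$, the layer is $\mathcal{K}_{\Gamma,\phi}=\{t\in T \mid x_\chi(t)=\phi(\chi)\ \forall\chi\in\Gamma\}$. It is a coset of the subtorus $H=\bigcap_{\chi\in\Gamma}\ker(x_\chi)$. Set $V_H=\{v\in V\mid \langle\chi,v\rangle=0\ \forall\chi\in\Gamma\}$; it is naturally identified with $X_*(H)\otimes_{\mathbb{Z}}\mathbb{R}$. Smooth fan: for linearly independent $e^1,\dots,e^h$, $C(e^1,\dots,e^h)$ is the cone of their nonnegative linear combinations. A smooth fan $\Delta$ in $V$ is a finite collection of cones such that each is of the form $C(e^1,\dots,e^r)$ with $e^1,\dots,e^r\in X_*(T)$ linearly independent and spanning a split direct summand of $X_*(T)$; every face of a cone in $\Delta$ is in $\Delta$; the intersection of two cones of $\Delta$ is a face of each. $K_\Delta$ is the associated smooth $T$-toric variety (containing $T$ as its open orbit). Cones $C\in\Delta$ correspond bijectively to $T$-stable affine open sets $U_C\subset K_\Delta$, with $\mathbb{C}[U_C]=\bigoplus_{\chi:\,\langle\chi,v\rangle\ge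 0\,\forall v\in C}\mathbb{C}x_\chi$, and to $T$-orbits $\mathcal{O}_C$, where $\mathcal{O}_C$ is the unique relatively closed orbit in $U_C$; $C_{\mathcal{O}}$ denotes the cone corresponding to an orbit $\mathcal{O}$. Property $(E)$: a subspace $U\subset V^*$ has property $(E)$ with respect to a cone $C(e^1,\dots,e^h)$ if $U$ has a basis $u_1,\dots,u_r$ with $\langle u_i,e^j\rangle\ge 0$ for all $i,j$. The layer $\mathcal{K}_{\Gamma,\phi}$ has property $(E)$ with respect to $\Delta$ if $\Gamma\otimes_{\mathbb{Z}}\mathbb{R}\subset X^*(T)\otimes_{\mathbb{Z}}\mathbb{R}=V^*$ has property $(E)$ with respect to every cone of $\Delta$. $\Delta_H$ is the collection of cones of $\Delta$ contained in $V_H$ (under the hypothesis it is a smooth fan in $V_H$ with respect to the lattice $X_*(H)$). ''$H$-variety with fan $\Delta_H$'' means the toric variety of $\Delta_H$ for the torus $H$, with dense $H$-orbit $\mathcal{K}_{\Gamma,\phi}$ (identified with $H$ by choosing a base point). *)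

(* Defs.v *)
From HB Require Import structures.
From Stdlib Require Import Relations.
From mathcomp Require Import all_boot all_order all_algebra.
From mathcomp Require Import all_classical all_reals all_analysis.
From mathcomp Require Import generic_quotient ring_quotient complex.
From mathcomp Require Import -(notations) mpoly.

Set Implicit Arguments.
Unset Strict Implicit.
Unset Printing Implicit Defensive.

Import Order.TTheory GRing.Theory Num.Theory.
Local Open Scope classical_set_scope.
Local Open Scope quotient_scope.
Local Open Scope ring_scope.

Definition homZ (U W : zmodType) : Type := {additive U -> W}.

Section HomZmodule.
Variables U W : zmodType.
Implicit Types f g h : homZ U W.

HB.instance Definition _ := gen_eqMixin (homZ U W).
HB.instance Definition _ := gen_choiceMixin (homZ U W).

Lemma homZ_ext f g : (forall x, f x = g x) -> f = g.
Proof.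
case: f g => [f [[hf]]] [g [[hg]]] /= /funext fg.
by subst g; rewrite (Prop_irrelevance hf hg).
Qed.

Definition homZ0 : homZ U W := \0.
Definition homZ_opp f : homZ U W := \- f.
Definition homZ_add f g : homZ U W := f \+ g.

Lemma homZ_addA : associative homZ_add.
Proof. by move=> f g h; apply: homZ_ext => x /=; rewrite addrA. Qed.
Lemma homZ_addC : commutative homZ_add.
Proof. by move=> f g; apply: homZ_ext => x /=; rewrite addrC. Qed.
Lemma homZ_add0 : left_id homZ0 homZ_add.
Proof. by move=> f; apply: homZ_ext => x /=; rewrite add0r. Qed.
Lemma homZ_addN : left_inverse homZ0 homZ_opp homZ_add.
Proof. by move=> f; apply: homZ_ext => x /=; rewrite addNr. Qed.

HB.instance Definition _ :=
  GRing.isZmodule.Build (homZ U W) homZ_addA homZ_addC homZ_add0 homZ_addN.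

End HomZmodule.

Section HomLmodule.
Variables (K : comNzRingType) (U : zmodType) (W : lmodType K).
Implicit Types f g : homZ U W.

Definition homZ_scale (a : K) f : homZ U W := a \*: f.

Lemma homZ_scaleA a b f : homZ_scale a (homZ_scale b f) = homZ_scale (a * b) f.
Proof. by apply: homZ_ext => x /=; rewrite scalerA. Qed.
Lemma homZ_scale1 : left_id 1 homZ_scale.
Proof. by move=> f; apply: homZ_ext => x /=; rewrite scale1r. Qed.
Lemma homZ_scaleDr : right_distributive homZ_scale +%R.
Proof. by move=> a f g; apply: homZ_ext => x /=; rewrite scalerDr. Qed.
Lemma homZ_scaleDl f : {morph homZ_scale^~ f : a b / a + b}.
Proof. by move=> a b; apply: homZ_ext => x /=; rewrite scalerDl. Qed.

HB.instance Definition _ := GRing.Zmodule_isLmodule.Build K (homZ U W)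
  homZ_scaleA homZ_scale1 homZ_scaleDr homZ_scaleDl.

End HomLmodule.

Definition is_lattice (L : zmodType) : Prop :=
  exists (n : nat) (b : 'I_n -> L),
    bijective (fun c : 'rV[int]_n => \sum_i b i *~ c 0 i).

Definition split_summand (L : zmodType) (A : set L) : Prop :=
  exists B : zmodClosed L,
    (forall x, exists a b, [/\ A a, b \in B & x = a + b]) /\
    (forall x, A x -> x \in B -> x = 0).

Definition lin_indep (K : nzRingType) (M : lmodType K) (r : nat)
    (u : 'I_r -> M) : Prop :=
  forall c : 'I_r -> K, \sum_i c i *: u i = 0 -> forall i, c i = 0.

Definition is_basis (K : nzRingType) (M : lmodType K) (U : set M) (r : nat)
    (u : 'I_r -> M) : Prop :=
  lin_indep u /\ U = [set w | exists c : 'I_r -> K, w = \sum_i c i *: u i].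

Section Fans.
Variables (R : realType) (X : zmodType).

Definition cochar : Type := homZ X int.

Definition Vspace : Type := homZ X R^o.
HB.instance Definition _ := GRing.Lmodule.on Vspace.

Definition cochar_vec (f : cochar) : Vspace := ( *~%R (1 : R^o)) \o f.

(* The image of S (x) R in V^* = X (x) R, whose elements are regarded as
   functions on V. *)
Definition tensorR (S : set X) : set (Vspace -> R^o) :=
  [set u : Vspace -> R^o | exists (m : nat) (chi : 'I_m -> X) (a : 'I_m -> R),
     (forall k, S (chi k)) /\ u = fun v => \sum_k a k *: v (chi k)].

Definition cone (r : nat) (e : 'I_r -> Vspace) : set Vspace :=
  [set v | exists2 a : 'I_r -> R, forall i, 0 <= a i & v = \sum_i a i *: e i].

Definition face (tau sigma : set Vspace) : Prop :=
  exists2 u, tensorR setT u &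
    (forall v, sigma v -> 0 <= u v) /\ tau = sigma `&` [set v | u v = 0].

Definition smooth_cone (sigma : set Vspace) : Prop :=
  exists (r : nat) (e : 'I_r -> cochar),
    [/\ lin_indep (fun i => cochar_vec (e i)),
        split_summand [set f : cochar | exists c : 'I_r -> int,
                                          f = \sum_i e i *~ c i]
      & sigma = cone (fun i => cochar_vec (e i))].

(* Nonemptiness is part of the notion: the variety of a fan contains the torus
   as the orbit of the cone {0}, a face of every cone. *)
Definition smooth_fan (Delta : set (set Vspace)) : Prop :=
  [/\ finite_set Delta, Delta !=set0,
      forall sigma, Delta sigma -> smooth_cone sigma,
      forall sigma tau, Delta sigma -> face tau sigma -> Delta tau
    & forall sigma tau, Delta sigma -> Delta tau ->
        face (sigma `&` tau) sigma /\ face (sigma `&` tau) tau].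

Definition property_E (U : set (Vspace -> R^o)) (h : nat)
    (e : 'I_h -> Vspace) : Prop :=
  exists (r : nat) (u : 'I_r -> Vspace -> R^o),
    is_basis U u /\ forall i j, 0 <= u i (e j).

Definition layer_property_E (Gamma : set X) (Delta : set (set Vspace)) : Prop :=
  forall (h : nat) (e : 'I_h -> Vspace),
    lin_indep e -> Delta (cone e) -> property_E (tensorR Gamma) e.

Definition annihilator (Gamma : set X) : set Vspace :=
  [set v | forall chi, Gamma chi -> v chi = 0].

Definition dual_semigroup (sigma : set Vspace) : set X :=
  [set chi | forall v, sigma v -> 0 <= v chi].

End Fans.

(* Varieties are handled as spaces with functions: a topological space with,
   on each open set W, a set of regular functions (only the values on W of a
   function regular on W matter). *)
Record funspace (K : fieldType) := FunSpace {
  fs_space :> topologicalType;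
  regular : set fs_space -> (fs_space -> K) -> Prop }.

Section SpacesWithFunctions.
Variable K : fieldType.

Definition fs_morphism (Y Z : funspace K) (f : Y -> Z) : Prop :=
  continuous f /\
  forall (W : set Z) (g : Z -> K), open W -> regular W g ->
    regular (f @^-1` W) (g \o f).

Definition fs_iso (Y Z : funspace K) (f : Y -> Z) : Prop :=
  exists g : Z -> Y,
    [/\ cancel f g, cancel g f, fs_morphism f & fs_morphism g].

(* The induced (reduced) structure on a subset. *)
Definition fs_sub (Y : funspace K) (Z : set Y) : funspace K :=
  @FunSpace K (set_type Z : topologicalType) (fun W f =>
    forall x, W x -> exists (W' : set Y) (g : Y -> K),
      [/\ open W', W' (set_val x), regular W' g
        & forall y, W y -> W' (set_val y) -> f y = g (set_val y)]).

Record fun_algebra (P : Type) := FunAlgebra {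
  algfun :> (P -> K) -> Prop;
  algfun_cst : forall c : K, algfun (fun=> c);
  algfunD : forall f g, algfun f -> algfun g -> algfun (fun p => f p + g p);
  algfunM : forall f g, algfun f -> algfun g -> algfun (fun p => f p * g p) }.

Definition zariski (P : choiceType) (A : fun_algebra P) : Type := P.

Section Zariski.
Variables (P : choiceType) (A : fun_algebra P).

HB.instance Definition _ := Choice.on (zariski A).

Definition zariski_open (W : set (zariski A)) : Prop :=
  forall p, W p -> exists a : P -> K,
    [/\ A a, a p != 0 & forall q, a q != 0 -> W q].

Lemma zariski_openT : zariski_open setT.
Proof.
move=> p _; exists (fun=> 1); split => //; first exact: algfun_cst.
exact: oner_neq0.
Qed.

Lemma zariski_openI : setI_closed zariski_open.
Proof.
move=> V W oV oW p [/oV [a [Aa ap aV]] /oW [b [Ab bp bW]]].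
exists (fun q => a q * b q); split; first exact: algfunM.
  by rewrite mulf_neq0.
by move=> q; rewrite mulf_eq0 negb_or => /andP[aq bq]; split; auto.
Qed.

Lemma zariski_open_bigU (I : Type) (F : I -> set (zariski A)) :
  (forall i, zariski_open (F i)) -> zariski_open (\bigcup_i F i).
Proof.
move=> oF p [i _ /oF [a [Aa ap aF]]]; exists a; split => // q aq.
by exists i => //; exact: aF.
Qed.

HB.instance Definition _ := isOpenTopological.Build (zariski A)
  zariski_openT zariski_openI zariski_open_bigU.

Definition zariski_space : funspace K :=
  @FunSpace K (zariski A : topologicalType) (fun W f =>
    forall p, W p -> exists a b : P -> K,
      [/\ A a, A b, b p != 0
        & forall q, W q -> b q != 0 -> f q = a q / b q]).

End Zariski.

Program Definition poly_algebra (N : nat) : fun_algebra 'rV[K]_N :=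
  @FunAlgebra 'rV[K]_N
    [set F : 'rV[K]_N -> K | exists q : mpoly N K,
               F = fun x : 'rV[K]_N => meval (fun i => x 0 i) q] _ _ _.
Next Obligation.
by move=> N c; exists (mpolyC N c); apply/funext => x; rewrite mevalC.
Qed.
Next Obligation.
move=> N f g [p ->] [q ->]; exists (p + q).
by apply/funext => x; rewrite mevalD.
Qed.
Next Obligation.
move=> N f g [p ->] [q ->]; exists (p * q).
by apply/funext => x; rewrite mevalM.
Qed.

Definition affine_space (N : nat) : funspace K := zariski_space (poly_algebra N).

(* Smooth = locally isomorphic to {g_1 = ... = g_k = 0, h <> 0} in an affine
   space, where dg_1, ..., dg_k are linearly independent at every point; the
   scheme defined by these equations is then reduced, so that the induced
   structure on the zero set is the right one. *)
Definition smooth_variety (Y : funspace K) : Prop :=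
  forall y : Y, exists W : set Y, [/\ open W, W y &
    exists (N k : nat) (g : 'I_k -> mpoly N K) (h : mpoly N K),
      let ev (x : 'rV[K]_N) q := meval (fun i => x 0 i) q in
      let Z : set (affine_space N) :=
        [set x | (forall i, ev x (g i) = 0) /\ ev x h != 0] in
      (forall x, Z x ->
         \rank (\matrix_(i < k, j < N) ev x (mderiv j (g i))) = k) /\
      exists f : fs_sub W -> fs_sub Z, fs_iso f].

End SpacesWithFunctions.

Section Torus.
Variables (R : realType) (X : zmodType).

(* T = hom(X, C^* ), the torus with character lattice X; x_chi(t) is t chi. *)
Record torus := Torus {
  torus_fun :> X -> R[i];
  torus0 : torus_fun 0 = 1;
  torusD : forall chi psi,
    torus_fun (chi + psi) = torus_fun chi * torus_fun psi }.

Program Definition torus_mul (s t : torus) : torus :=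
  @Torus (fun chi => s chi * t chi) _ _.
Next Obligation. by move=> s t /=; rewrite !torus0 mulr1. Qed.
Next Obligation. by move=> s t chi psi /=; rewrite !torusD mulrACA. Qed.

Definition is_character_on (Gamma : set X) (phi : X -> R[i]) : Prop :=
  phi 0 = 1 /\
  forall chi psi, Gamma chi -> Gamma psi -> phi (chi + psi) = phi chi * phi psi.

Definition layer (Gamma : set X) (phi : X -> R[i]) : set torus :=
  [set t : torus | forall chi, Gamma chi -> t chi = phi chi].

End Torus.

Section ToricVariety.
Variables (R : realType) (X : zmodType).
Local Notation V := (Vspace R X).
Local Notation T := (torus R X).

Lemma dual_semigroup0 (sigma : set V) : dual_semigroup sigma 0.
Proof. by move=> v _; rewrite raddf0. Qed.

Lemma dual_semigroupD (sigma : set V) chi psi :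
  dual_semigroup sigma chi -> dual_semigroup sigma psi ->
  dual_semigroup sigma (chi + psi).
Proof. by move=> h1 h2 v sv; rewrite raddfD addr_ge0 ?h1 ?h2. Qed.

(* A point of U_sigma = Spec C[S], S the dual semigroup of sigma, is a monoid
   morphism S -> (C, * ); it is extended by 0 outside S. *)
Record chart (sigma : set V) := Chart {
  chart_fun :> X -> R[i];
  chart0 : chart_fun 0 = 1;
  chartD : forall chi psi,
    dual_semigroup sigma chi -> dual_semigroup sigma psi ->
    chart_fun (chi + psi) = chart_fun chi * chart_fun psi;
  chart_out : forall chi, ~ dual_semigroup sigma chi -> chart_fun chi = 0 }.

HB.instance Definition _ sigma := gen_eqMixin (chart sigma).
HB.instance Definition _ sigma := gen_choiceMixin (chart sigma).

Program Definition chart_algebra (sigma : set V) :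
    fun_algebra R[i] (chart sigma) :=
  @FunAlgebra _ (chart sigma)
    [set F : chart sigma -> R[i] |
       exists (m : nat) (c : 'I_m -> R[i]) (chi : 'I_m -> X),
       (forall k, dual_semigroup sigma (chi k)) /\
       F = fun p => \sum_k c k * p (chi k)] _ _ _.
Next Obligation.
move=> sigma c; exists 1%N, (fun=> c), (fun=> 0).
split=> [_|]; first exact: dual_semigroup0.
by apply/funext => p; rewrite big_ord1 chart0 mulr1.
Qed.
Next Obligation.
move=> sigma _ _ [m [c [chi [hchi ->]]]] [n [d [psi [hpsi ->]]]] /=.
pose merge (Y : Type) (a : 'I_m -> Y) (b : 'I_n -> Y) (k : 'I_(m + n)) : Y :=
  match fintype.split k with inl i => a i | inr j => b j end.
exists (m + n)%N, (merge _ c d), (merge _ chi psi).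
split=> [k|]; first by rewrite /merge; case: (fintype.split k).
apply/funext => p; rewrite big_split_ord /=; congr (_ + _).
  by apply: eq_bigr => i _; rewrite /merge (unsplitK (inl i)).
by apply: eq_bigr => i _; rewrite /merge (unsplitK (inr i)).
Qed.
Next Obligation.
move=> sigma _ _ [m [c [chi [hchi ->]]]] [n [d [psi [hpsi ->]]]] /=.
pose I := ('I_m * 'I_n)%type.
exists #|{: I}|, (fun k => c (enum_val k).1 * d (enum_val k).2),
  (fun k => chi (enum_val k).1 + psi (enum_val k).2).
split=> [k|]; first exact: dual_semigroupD.
apply/funext => p; rewrite big_distrlr /= pair_big /=.
rewrite (reindex (fun k : 'I_#|{: I}| => enum_val k)) /=; last first.
  exact/onW_bij/enum_val_bij.
by apply: eq_bigr => k _; rewrite chartD // mulrACA.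
Qed.

Definition chart_space (sigma : set V) : funspace R[i] :=
  zariski_space (chart_algebra sigma).

Definition atlas (Delta : set (set V)) : Type :=
  {sigma : set_type Delta & chart_space (set_val sigma)}.

Section Glueing.
Variable Delta : set (set V).

(* For tau contained in sigma (so tau is a face of sigma), U_tau is open in
   U_sigma, a point of U_tau being sent to its restriction to the dual
   semigroup of sigma. *)
Definition glue_step (x y : atlas Delta) : Prop :=
  (set_val (tag y) `<=` set_val (tag x)) /\
  forall chi, dual_semigroup (set_val (tag x)) chi ->
    (tagged x : chart _) chi = (tagged y : chart _) chi.

Definition glue (x y : atlas Delta) : bool :=
  `[< clos_refl_sym_trans _ glue_step x y >].

Lemma glue_equiv_class : equiv_class_of glue.
Proof.
split=> [x|x y|y x z]; first by apply/asboolP; exact: rst_refl.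
  by apply/asboolP/asboolP => ?; exact: rst_sym.
by move=> /asboolP xy /asboolP yz; apply/asboolP; exact: rst_trans xy yz.
Qed.

Canonical glue_equiv := EquivRelPack glue_equiv_class.

Definition toric_quot : Type := quotient_topology {eq_quot glue_equiv}.

Definition toric_pi (sigma : set_type Delta) (p : chart (set_val sigma)) :
    toric_quot :=
  \pi_({eq_quot glue_equiv}) (existT _ sigma p).

Definition toric_repr (x : toric_quot) : atlas Delta :=
  repr (x : {eq_quot glue_equiv}).

Definition toric_variety : funspace R[i] :=
  @FunSpace _ (toric_quot : topologicalType) (fun W f =>
    forall sigma : set_type Delta,
      @regular _ (chart_space (set_val sigma))
        (@toric_pi sigma @^-1` W) (f \o @toric_pi sigma)).

End Glueing.

Program Definition chart_act (sigma : set V) (t : T) (p : chart sigma) :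
    chart sigma :=
  @Chart sigma (fun chi => t chi * p chi) _ _ _.
Next Obligation. by move=> sigma t p /=; rewrite torus0 chart0 mulr1. Qed.
Next Obligation.
by move=> sigma t p chi psi h1 h2 /=; rewrite torusD chartD // mulrACA.
Qed.
Next Obligation. by move=> sigma t p chi h /=; rewrite chart_out // mulr0. Qed.

Program Definition chart_of_torus (sigma : set V) (t : T) : chart sigma :=
  @Chart sigma
    (fun chi => if `[< dual_semigroup sigma chi >] then t chi else 0) _ _ _.
Next Obligation.
move=> sigma t /=; case: asboolP => [_|[]]; first exact: torus0.
exact: dual_semigroup0.
Qed.
Next Obligation.
move=> sigma t chi psi h1 h2 /=; case: asboolP => [_|[]]; last first.
  exact: dual_semigroupD.
by do 2![case: asboolP => [_|//]]; rewrite torusD.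
Qed.
Next Obligation. by move=> sigma t chi h /=; case: asboolP. Qed.

Variable Delta : set (set V).
Local Notation K := (toric_variety Delta).

Definition toric_act (t : T) (x : K) : K :=
  toric_pi (chart_act t (tagged (toric_repr x))).

(* x is the point t of the torus T inside K. *)
Definition is_torus_point (t : T) (x : K) : Prop :=
  exists sigma : set_type Delta, x = toric_pi (chart_of_torus (set_val sigma) t).

Definition affine_open (sigma : set V) : set K :=
  [set x | exists (tau : set_type Delta) (p : chart (set_val tau)),
     set_val tau = sigma /\ x = toric_pi p].

Definition is_orbit (O : set K) : Prop :=
  exists x : K, O = [set toric_act t x | t in setT].

(* O is a relatively closed orbit of U_sigma, i.e. sigma = C_O. *)
Definition orbit_cone (O : set K) (sigma : set V) : Prop :=
  [/\ is_orbit O, Delta sigma, O `<=` affine_open sigma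
    & exists2 F : set K, closed F & O = F `&` affine_open sigma].

Definition layer_closure (Gamma : set X) (phi : X -> R[i]) : set K :=
  closure [set x : K | exists2 t, layer Gamma phi t & is_torus_point t x].

End ToricVariety.

(* The subtorus H of T defined by Gamma: its character lattice is X / Gamma. *)
Section Subtorus.
Variables (R : realType) (X : zmodType) (Gamma : zmodClosed X).

Definition charH : zmodType := Quotient.quot Gamma.

Definition charH_res : {additive X -> charH} := \pi_(Quotient.quot Gamma).

Program Definition torusH_incl (h : torus R charH) : torus R X :=
  @Torus R X (fun chi => h (charH_res chi)) _ _.
Next Obligation. by move=> h /=; rewrite raddf0 torus0. Qed.
Next Obligation. by move=> h chi psi /=; rewrite raddfD torusD. Qed.

(* X_*(H) (x) R -> V, with image V_H. *)
Definition VH_incl (w : Vspace R charH) : Vspace R X :=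
  (w : {additive _ -> _}) \o charH_res.

Definition coneH (sigma : set (Vspace R X)) : set (Vspace R charH) :=
  VH_incl @^-1` sigma.

Definition fanH (Delta : set (set (Vspace R X))) : set (set (Vspace R charH)) :=
  [set coneH sigma | sigma in
     [set sigma | Delta sigma /\ sigma `<=` annihilator [set` Gamma]]].

End Subtorus.

Arguments layer_closure {R X} Delta Gamma phi.
Arguments coneH {R X} Gamma sigma.
Arguments fanH {R X} Gamma Delta.

(* Main.v *)
Require Import Defs.
From HB Require Import structures.
From Stdlib Require Import Relations.
From mathcomp Require Import all_boot all_order all_algebra.
From mathcomp Require Import all_classical all_reals all_analysis.
From mathcomp Require Import generic_quotient ring_quotient complex.
From mathcomp Require Import -(notations) mpoly.

(* Property (E) yields, for every cone [sigma] of the fan, a character [m] in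
   [Gamma] which is nonnegative on [sigma] and cuts out exactly
   [sigma `&` V_H], a face of [sigma].  On the layer [m] takes the nonzero value
   [phi m], so the closure of the layer meets [U_sigma] only inside
   [U_(sigma `&` V_H)], where it is given by the equations [x_chi = phi chi] for
   [chi] in [Gamma].  For [sigma] contained in [V_H] the characters of [Gamma]
   are invertible on [U_sigma], and [p' |-> (chi |-> t0 chi * p' (chi mod
   Gamma))] identifies the chart of [sigma] in the [H]-toric variety with this
   closed subset of [U_sigma].  These identifications are compatible with the
   gluing, with the action of [H] and with the orbits, which are recognised in
   a chart by the vanishing of the noninvertible characters. *)

Set Implicit Arguments.
Unset Strict Implicit.
Unset Printing Implicit Defensive.

Import Order.TTheory GRing.Theory Num.Theory.
Local Open Scope classical_set_scope.
Local Open Scope quotient_scope.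
Local Open Scope ring_scope.

(** * Lattices *)

(** The basis provided by (E) is real and depends on the cone, whereas the character [m] has to be
    integral; this is why scaling and rounding are needed. Gluing is the equivalence relation
    generated by restriction of points, so an equality in a toric variety says little by itself: the
    fan axioms enter when it is reduced to agreement on the chart of an intersection of two cones.
    The map from the toric variety of [H] is handled through its graph, so that well-definedness and
    injectivity are both read off from this criterion. Limits are algebraic: a Zariski open set
    containing the value at 0 of a polynomial curve contains another value of the curve, because a
    nonzero polynomial has a nonzero nonroot. No equations of the closure are differentiated for
    smoothness: charts of a smooth fan are products of lines and punctured lines, and the closure
    inherits smoothness through the isomorphism. Splitness of [Gamma] makes the character group of
    [H] a lattice and extends [phi] to all characters, which gives the base point [t0]. *)

Lemma homZ_mk (U W : zmodType) (f : U -> W) :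
  zmod_morphism f -> exists g : homZ U W, g =1 f.
Proof.
move=> fB; pose a := GRing.isZmodMorphism.Build U W f fB.
by exists (HB.pack_for (GRing.Additive.type U W) f a : {additive U -> W}).
Qed.

Section HomEval.
Variables U W : zmodType.
Implicit Types f g : homZ U W.

Lemma homZ_eval u : exists ev : homZ (homZ U W) W, forall f, ev f = f u.
Proof. by apply: (@homZ_mk _ _ (fun f : homZ U W => f u)) => f g. Qed.

Lemma homZ_sum (I : finType) (P : pred I) (f : I -> homZ U W) u :
  (\sum_(i | P i) f i : homZ U W) u = \sum_(i | P i) f i u.
Proof.
have [ev evE] := homZ_eval u.
by rewrite -evE raddf_sum; apply: eq_bigr => i _; rewrite evE.
Qed.

Lemma homZ_mulz f (m : int) u : (f *~ m : homZ U W) u = f u *~ m.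
Proof. by have [ev evE] := homZ_eval u; rewrite -!evE raddfMz. Qed.

End HomEval.

(** Any finite index type is allowed, because the Smith normal form below selects a subset of the
    indices. *)
Definition dual_bases (X : zmodType) (I : finType) (x : I -> X)
    (f : I -> cochar X) : Prop :=
  (forall i j, f i (x j) = (i == j)%:R) /\
  (forall chi, chi = \sum_i x i *~ f i chi).

Lemma dual_bases_coord (X : zmodType) (I : finType) (x : I -> X) f
    (c : I -> int) i :
  dual_bases x f -> f i (\sum_j x j *~ c j) = c i.
Proof.
move=> [fx _]; rewrite raddf_sum (bigD1 i) //= big1 ?addr0.
  by rewrite raddfMz fx eqxx intz.
by move=> l lk; rewrite raddfMz fx eq_sym (negPf lk) mul0rz.
Qed.

Lemma is_latticeP (X : zmodType) :
  is_lattice X <-> exists (I : finType) (x : I -> X) f, dual_bases x f.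
Proof.
split=> [[n [b [g bK gK]]]|[I [x [f xf]]]].
  have sumB (c d : 'rV[int]_n) : \sum_i b i *~ (c - d) 0 i =
      \sum_i b i *~ c 0 i - \sum_i b i *~ d 0 i.
    by rewrite -sumrB; apply: eq_bigr => i _; rewrite !mxE mulrzBr.
  have gB chi psi : g (chi - psi) = g chi - g psi.
    by apply: (can_inj bK); rewrite sumB !gK.
  have f_ (i : 'I_n) : exists fi : cochar X, fi =1 (fun chi => g chi 0 i).
    by apply: homZ_mk => chi psi; rewrite gB !mxE.
  have [f fE] := choice f_.
  exists 'I_n, b, f; split=> [i j|chi]; last first.
    by under eq_bigr do rewrite fE; rewrite gK.
  have -> : b j = \sum_k b k *~ (delta_mx 0 j : 'rV[int]_n) 0 k.
    rewrite (bigD1 j) //= big1 => [|k kj]; rewrite !mxE ?eqxx ?(negPf kj) //.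
    by rewrite addr0.
  by rewrite fE bK !mxE.
exists #|{: I}|, (fun k => x (enum_val k)).
have sumE (c : I -> int) :
    \sum_(k < #|{: I}|) x (enum_val k) *~ c (enum_val k) = \sum_i x i *~ c i.
  rewrite [RHS](reindex (fun k : 'I_#|{: I}| => enum_val k)) //=.
  exact/onW_bij/enum_val_bij.
exists (fun chi => \row_k f (enum_val k) chi) => [c|chi].
  have -> : \sum_i x (enum_val i) *~ c 0 i = \sum_i x i *~ c 0 (enum_rank i).
    by rewrite -sumE; apply: eq_bigr => k _; rewrite enum_valK.
  apply/rowP => k; rewrite !mxE.
  rewrite (dual_bases_coord (fun i => c 0 (enum_rank i)) _ xf).
  by rewrite enum_valK.
rewrite [RHS](xf.2 chi) -[RHS](sumE (f ^~ chi)).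
by apply: eq_bigr => k _; rewrite mxE.
Qed.

(* With [M = L D R] the Smith normal form of the matrix of [s \o p], the image
   of [s] is spanned by the nonzero rows of [D R]. *)
Lemma retract_lattice (X Y : zmodType) (p : {additive X -> Y})
    (s : {additive Y -> X}) :
  cancel s p -> is_lattice X -> is_lattice Y.
Proof.
move=> sK [n [b [g bK gK]]].
pose vec (c : 'rV[int]_n) := \sum_i b i *~ c 0 i.
have vecB c d : vec (c - d) = vec c - vec d.
  by rewrite -sumrB; apply: eq_bigr => i _; rewrite !mxE mulrzBr.
have [v vE] := homZ_mk vecB.
have gB : zmod_morphism g.
  by move=> chi psi; apply: (can_inj bK) => /=;
    rewrite gK -/(vec _) vecB /vec !gK.
have [w wE] := homZ_mk gB.
have vK c : w (v c) = c by rewrite vE wE; exact: bK.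
have wK chi : v (w chi) = chi by rewrite vE wE; exact: gK.
pose M := \matrix_(i, j) w (s (p (v (delta_mx 0 i)))) 0 j.
have wsp c : w (s (p (v c))) = c *m M.
  rewrite {1}[c]row_sum_delta !raddf_sum /= mulmx_sum_row.
  apply: eq_bigr => i _; rewrite -[c 0 i]intz !scaler_int !raddfMz.
  by congr (_ *~ _); apply/rowP => j; rewrite !mxE.
have [L uL [D0 uD [d _ defM]]] := int_Smith_normal_form M.
pose I := {i : 'I_n | d`_i != 0}.
pose N := invmx D0.
pose y (i : I) := p (v (row (val i) (invmx L))).
have wy (i : I) : w (s (y i)) *m N = d`_(val i) *: delta_mx 0 (val i).
  rewrite wsp defM !mulmxA mulmxK // -row_mul mulVmx // -row_mul mul1mx.
  apply/rowP => j; rewrite !mxE eqxx /= eq_sym val_eqE.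
  by case: eqP => _; rewrite ?mulr1 ?mulr0.
(* Since [s \o p] fixes [s z], the coordinate row of [s z] equals its own product with [M]; hence
   its coefficient on row [i] of [D0] is a multiple of the divisor. The divisions defining [f] are
   therefore exact, and so additive. *)
have dvd_d (z : Y) i : exists q, (w (s z) *m N) 0 i = q * d`_i.
  exists ((w (s z) *m L) 0 i).
  rewrite -{1}[z]sK -[s z in LHS]wK wsp defM !mulmxA mulmxK // mxE (bigD1 i)
    //=.
  rewrite big1 ?addr0 => [|j ji]; rewrite mxE ?eqxx //.
  by rewrite val_eqE (negPf ji) mulr0.
have f_ (i : I) : exists f : cochar Y,
    f =1 fun z => divz ((w (s z) *m N) 0 (val i)) d`_(val i).
  apply: homZ_mk => z z'; rewrite !raddfB /= mulmxBl mxE [in X in _ + X]mxE.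
  have [q ->] := dvd_d z (val i); have [q' ->] := dvd_d z' (val i).
  by rewrite -mulrBl !mulzK // (valP i).
have [f fE] := choice f_.
apply/is_latticeP; exists I, y, f; split=> [i j|z].
  rewrite fE wy !mxE eqxx /= val_eqE eq_sym.
  have di : d`_(sval i) != 0 := valP i.
  by case: eqP => [->|_]; rewrite ?mulr1 ?mulr0 ?div0z // divzz di.
apply: (can_inj sK); apply: (can_inj wK).
have uN : N \in unitmx by rewrite unitmx_inv.
rewrite -[LHS](mulmxK uN) -[RHS](mulmxK uN); congr (_ *m _).
rewrite !raddf_sum /= mulmx_suml.
apply/rowP => k; rewrite summxE.
have wyz i : (w (s (y i *~ f i z)) *m N) 0 k =
    if k == val i then (w (s z) *m N) 0 k else 0.
  rewrite !raddfMz /= -scaler_int -scalemxAl wy intz 3!mxE eqxx /=.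
  have di : d`_(sval i) != 0 := valP i.
  case: eqP => [->|_]; rewrite ?mulr1 ?mulr0 // fE.
  by have [q ->] := dvd_d z (val i); rewrite mulzK.
under eq_bigr do rewrite wyz.
have [d0|dk] := eqVneq d`_k 0.
  have [q ->] := dvd_d z k; rewrite d0 mulr0 big1 // => i _.
  by case: ifP => // /eqP ki; have := valP i; rewrite -ki d0 eqxx.
rewrite (bigD1 (Sub k dk : I)) //= eqxx big1 ?addr0 // => i.
by rewrite -val_eqE /= eq_sym => /negPf ->.
Qed.

Lemma subr_subACA (V : zmodType) (x y z t : V) :
  (x - y) - (z - t) = (x - z) - (y - t).
Proof. by rewrite !opprD !opprK addrACA. Qed.

(** The section sends a class to the component in the complement [B] of any representative. Two
    choices differ by an element of [Gamma] and of [B], that is by 0; the same argument gives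
    additivity. *)
Lemma split_retract (X : zmodType) (Gamma : zmodClosed X) :
  split_summand [set` Gamma] ->
  exists s : {additive charH Gamma -> X}, cancel s (charH_res Gamma).
Proof.
move=> [B [XB GB]].
have b_ x : exists b, b \in B /\ x - b \in Gamma.
  by have [a [b [ag bB ->]]] := XB x; exists b; rewrite addrK.
have [b bP] := choice b_.
have bu x y : x - y \in Gamma -> b x = b y.
  move=> xy; apply/eqP; rewrite -subr_eq0; apply/eqP; apply: GB.
    have [[_ gx] [_ gy]] := (bP x, bP y).
    have -> : b x - b y = (x - y) - ((x - b x) - (y - b y)).
      by rewrite [X in _ - X]subr_subACA subKr.
    by rewrite /= rpredB // rpredB.
  by rewrite rpredB //; [case: (bP x)|case: (bP y)].
have bB : zmod_morphism (fun c : charH Gamma => b (repr c)).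
  move=> c d; have -> : b (repr (c - d)) = b (repr c - repr d).
    apply: bu; rewrite Quotient.idealrBE reprK.
    by rewrite raddfB /= !reprK.
  have [[Bx gx] [By gy]] := (bP (repr c), bP (repr d)).
  have [Bz gz] := bP (repr c - repr d).
  apply/eqP; rewrite -subr_eq0; apply/eqP; apply: GB; last first.
    by rewrite rpredB // rpredB.
  have -> : b (repr c - repr d) - (b (repr c) - b (repr d)) =
     (repr c - b (repr c)) - (repr d - b (repr d)) -
     (repr c - repr d - b (repr c - repr d)).
    rewrite (subr_subACA (repr c)) (subr_subACA (repr c - repr d)).
    by rewrite subrr sub0r [RHS]opprB.
  by rewrite /= rpredB // rpredB.
have [s sE] := homZ_mk bB.
exists s => c; rewrite sE -[RHS]reprK; apply/eqP.
rewrite -Quotient.idealrBE -opprB rpredN; exact: (bP _).2.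
Qed.

Lemma quot_lattice (X : zmodType) (Gamma : zmodClosed X) :
  split_summand [set` Gamma] -> is_lattice X -> is_lattice (charH Gamma).
Proof. by move=> /split_retract[s sK]; apply: (retract_lattice sK). Qed.

Lemma zmodClosed_of (X : zmodType) (P : set X) :
  P 0 -> (forall x y, P x -> P y -> P (x - y)) ->
  exists N : zmodClosed X, [set` N] = P.
Proof.
move=> P0 PB; pose p : {pred X} := [pred x | `[< P x >]].
have pP : GRing.zmod_closed p.
  by split=> [|x y]; rewrite !inE; [exact: P0|exact: PB].
pose a := GRing.isZmodClosed.Build X p pP.
exists (HB.pack_for (zmodClosed X) p a : zmodClosed X).
by apply/seteqP; split=> x /=; rewrite !inE.
Qed.

Lemma charH_res_eq0 (X : zmodType) (Gamma : zmodClosed X) chi :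
  (charH_res Gamma chi == 0) = (chi \in Gamma).
Proof.
rewrite -[chi in RHS]subr0 Quotient.idealrBE; congr (_ == _).
by rewrite -(raddf0 (charH_res Gamma)).
Qed.

Lemma raddf_sum_mulz (X W : zmodType) (I : finType) (g : homZ X W) (x : I -> X)
    c :
  g (\sum_i x i *~ c i) = \sum_i g (x i) *~ c i.
Proof. by rewrite raddf_sum; apply: eq_bigr => i _; rewrite raddfMz. Qed.

Lemma sum_delta (I : finType) (c : I -> int) i :
  \sum_j ((i == j)%:R : int) *~ c j = c i.
Proof.
rewrite (bigD1 i) //= eqxx intz big1 ?addr0 // => j ji.
by rewrite eq_sym (negPf ji) mul0rz.
Qed.

(** The generators [e] of a smooth cone completed by [f] to a basis of the dual lattice, with the
    dual basis of [X]. The [x i] will be the coordinates of the chart that may vanish, the [y k] the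
    invertible ones: the chart is an affine space times a torus. *)
Definition adapted_basis (X : zmodType) (r : nat) (e : 'I_r -> cochar X)
    (J : finType) (x : 'I_r -> X) (y : J -> X) (f : J -> cochar X) : Prop :=
  [/\ forall i j, e i (x j) = (i == j)%:R,
      forall i k, e i (y k) = 0,
      forall k i, f k (x i) = 0,
      forall k l, f k (y l) = (k == l)%:R
    & forall chi, chi = \sum_i x i *~ e i chi + \sum_k y k *~ f k chi].

Section AdaptedBasis.
Variables (X : zmodType) (r : nat) (e : 'I_r -> cochar X).
Hypothesis latX : is_lattice X.
Hypothesis splite : split_summand
  [set f : cochar X | exists c : 'I_r -> int, f = \sum_i e i *~ c i].
Hypothesis freee : forall c : 'I_r -> int, \sum_i e i *~ c i = 0 ->
  forall i, c i = 0.

(** The coefficient of [e i], read along the complement [B], is an integral functional on the dual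
    lattice. As [X] is a lattice, such a functional is evaluation at an element of [X], written here
    in dual bases. *)
Lemma dual_elements : exists x : 'I_r -> X, forall i j, e i (x j) = (i == j)%:R.
Proof.
have [B [eB eB0]] := splite.
have c_ (f : cochar X) : exists c : 'I_r -> int, f - \sum_i e i *~ c i \in B.
  have [a [b [[c ->] bB ->]]] := eB f; exists c.
  by rewrite addrC addKr.
have [c cP] := choice c_.
have sumB (u v : 'I_r -> int) :
  \sum_i e i *~ (u i - v i) = \sum_i e i *~ u i - \sum_i e i *~ v i.
  by rewrite -sumrB; apply: eq_bigr => i _; rewrite mulrzBr.
have cu f (u : 'I_r -> int) : f - \sum_i e i *~ u i \in B -> c f = u.
  move=> fB; apply/funext => i; apply/eqP; rewrite -subr_eq0; apply/eqP.
  apply: (freee (c := fun i => c f i - u i)) i; apply: eB0.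
    by exists (fun i => c f i - u i).
  rewrite sumB; have := rpredB fB (cP f).
  by rewrite opprB addrC addrA subrK.
have ci_ i : exists ci : homZ (cochar X) int, ci =1 (c ^~ i).
  apply: homZ_mk => f g.
  rewrite (@cu (f - g) (fun i => c f i - c g i)) // sumB.
  by rewrite subr_subACA rpredB.
have [ci ciE] := choice ci_.
have /is_latticeP[I [b [b' [_ bb']]]] := latX.
exists (fun i => \sum_k b k *~ ci i (b' k)) => i j.
have -> : (i == j)%:R = ci j (e i).
  rewrite ciE (@cu _ (fun k => (k == i)%:R)) 1?eq_sym //.
  rewrite (bigD1 i) //= eqxx big1 ?addr0 => [|k /negPf ->];
    last by rewrite mulr0z.
  by rewrite mulr1z subrr rpred0.
rewrite raddf_sum_mulz.
rewrite [in RHS](_ : e i = \sum_k b' k *~ e i (b k)); last first.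
  apply: homZ_ext => chi; rewrite homZ_sum {1}(bb' chi) raddf_sum_mulz.
  by apply: eq_bigr => k _; rewrite homZ_mulz !mulrzz mulrC.
rewrite [RHS]raddf_sum_mulz; apply: eq_bigr => k _.
by rewrite !mulrzz mulrC.
Qed.

(** [P] projects [X] onto the span [N] of the [x i] along the common kernel of the [e i]. The
    quotient by [N] is again a lattice; its basis is lifted to [X] and corrected by [P] so as to
    land in that kernel. *)
Lemma adapted_basis_exists :
  exists (J : finType) (x : 'I_r -> X) (y : J -> X) f, adapted_basis e x y f.
Proof.
have [x ex] := dual_elements.
pose P chi := \sum_i x i *~ e i chi.
have PB chi psi : P (chi - psi) = P chi - P psi.
  by rewrite /P -sumrB; apply: eq_bigr => i _; rewrite raddfB mulrzBr.
have eP i chi : e i (P chi) = e i chi.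
  rewrite raddf_sum_mulz -[RHS](@sum_delta _ (e ^~ chi)).
  by apply: eq_bigr => j _; rewrite ex.
have P0 chi : (forall i, e i chi = 0) -> P chi = 0.
  by move=> h; rewrite /P big1 // => i _; rewrite h mulr0z.
have PP chi : P (P chi) = P chi.
  by rewrite {1}/P; apply: eq_bigr => i _; rewrite eP.
have [N NE] : exists N : zmodClosed X, [set` N] = [set chi | P chi = chi].
  apply: zmodClosed_of => [|a b /= Pa Pb]; first by rewrite /= P0 // => i;
    rewrite raddf0.
  by rewrite PB Pa Pb.
have [B BE] : exists B : zmodClosed X, [set` B] = [set chi | P chi = 0].
  apply: zmodClosed_of => [|a b /= Pa Pb]; first by rewrite /= P0 // => i;
    rewrite raddf0.
  by rewrite PB Pa Pb subrr.
have inN chi : (chi \in N) <-> P chi = chi.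
  by have /seteqP[h h'] := NE; split=> [/h|/h'].
have inB chi : (chi \in B) <-> P chi = 0.
  by have /seteqP[h h'] := BE; split=> [/h|/h'].
have splitN : split_summand [set` N].
  exists B; split=> [chi|chi /= /inN <- /inB]; last by rewrite PP.
  exists (P chi), (chi - P chi); split; rewrite /= ?subrKC //.
    exact/inN.
  by apply/inB; rewrite PB PP subrr.
have /is_latticeP[J [y [f [fy yf]]]] := quot_lattice splitN latX.
pose z k := repr (y k) - P (repr (y k)).
have f'_ k : exists g : cochar X, g =1 f k \o charH_res N.
  by apply: homZ_mk => a b /=; rewrite !raddfB.
have [f' f'E] := choice f'_.
have resP chi : charH_res N (P chi) = 0.
  by apply/eqP; rewrite charH_res_eq0; apply/inN.
have resz k : charH_res N (z k) = y k.
  by rewrite raddfB /= resP subr0 /charH_res reprK.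
exists J, x, z, f'; split=> // [i k|k i|k l|chi].
- by rewrite raddfB /= eP subrr.
- rewrite f'E /= (_ : x i = P (x i)) ?resP ?raddf0 // /P (bigD1 i) //= ex eqxx.
  rewrite mulr1z big1 ?addr0 // => j ji.
  by rewrite ex (negPf ji) mulr0z.
- by rewrite f'E /= resz.
pose rho := chi - P chi - \sum_k z k *~ f' k chi.
suff : rho = 0 by move=> /eqP; rewrite !subr_eq add0r addrC => /eqP.
have Pz k : P (z k) = 0 by rewrite PB PP subrr.
have Prho : P rho = 0.
  apply: P0 => i; rewrite !raddfB /= eP subrr sub0r raddf_sum_mulz big1 ?oppr0
    //.
  by move=> k _; rewrite raddfB /= eP subrr mul0rz.
rewrite -Prho; symmetry; apply/inN.
rewrite -charH_res_eq0 2!(raddfB (charH_res N)) resP subr0.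
rewrite [X in X - _](yf (charH_res N chi)) raddf_sum -sumrB big1 // => k _.
by rewrite (raddfMz (charH_res N)) resz f'E subrr.
Qed.

End AdaptedBasis.

(** * Smooth cones and fans *)

Section Cones.
Variables (R : realType) (X : zmodType).
Local Notation V := (Vspace R X).
Implicit Types (sigma tau rho : set V) (chi psi m : X) (v : V).

(** The characters that are invertible on the chart of [sigma]. *)
Definition perp sigma chi := forall v, sigma v -> v chi = 0.

(** A face with an integral supporting functional: the chart of [tau] is then the locus in the chart
    of [sigma] where [m] does not vanish. *)
Definition cuts m tau sigma :=
  dual_semigroup sigma m /\ tau = sigma `&` [set v | v m = 0].

Lemma cuts_face m tau sigma : cuts m tau sigma -> face tau sigma.
Proof.
move=> [Sm ->]; exists (fun v => v m).
  exists 1%N, (fun=> m), (fun=> 1); split=> //.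
  by apply/funext => v; rewrite big_ord1 scale1r.
by split=> // v /Sm.
Qed.

Lemma cuts_sub m tau sigma : cuts m tau sigma -> tau `<=` sigma.
Proof. by move=> [_ ->] v []. Qed.

Lemma cuts_eq0 m tau sigma v : cuts m tau sigma -> tau v -> v m = 0.
Proof. by move=> [_ ->] []. Qed.

Lemma cutsI m m' tau tau' sigma : cuts m tau sigma -> cuts m' tau' sigma ->
  cuts (m + m') (tau `&` tau') sigma.
Proof.
move=> [Sm ->] [Sm' ->]; split; first exact: dual_semigroupD.
apply/seteqP; split=> v /=.
  by move=> [[sv v0] [_ v0']]; split=> //; rewrite raddfD v0 v0' addr0.
move=> [sv]; rewrite raddfD => /eqP.
by rewrite paddr_eq0 ?Sm ?Sm' // => /andP[/eqP v0 /eqP v0'].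
Qed.

Lemma sub_dual_semigroup sigma tau :
  tau `<=` sigma -> dual_semigroup sigma `<=` dual_semigroup tau.
Proof. by move=> ts chi S v /ts; exact: S. Qed.

Lemma cuts_dualN m tau sigma : cuts m tau sigma -> dual_semigroup tau (- m).
Proof. by move=> cm v tv; rewrite raddfN (cuts_eq0 cm tv) oppr0. Qed.

Lemma cuts_dual m tau sigma : cuts m tau sigma -> dual_semigroup tau m.
Proof. by move=> cm v tv; rewrite (cuts_eq0 cm tv). Qed.

Lemma perp_dual sigma chi : perp sigma chi -> dual_semigroup sigma chi.
Proof. by move=> h v /h ->. Qed.

Lemma perpN sigma chi : perp sigma chi -> perp sigma (- chi).
Proof. by move=> h v /h; rewrite raddfN => ->; rewrite oppr0. Qed.

Lemma dual_semigroupMn sigma chi n :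
  dual_semigroup sigma chi -> dual_semigroup sigma (chi *+ n).
Proof. by move=> S v sv; rewrite raddfMn mulrn_wge0 // S. Qed.

Lemma cochar_vecE (e : cochar X) chi : cochar_vec R e chi = (e chi)%:~R.
Proof. by []. Qed.

Section Coordinates.
Variables (r : nat) (e : 'I_r -> cochar X) (x : 'I_r -> X).
Hypothesis ex : forall i j, e i (x j) = (i == j)%:R.
Let sigma : set V := cone (fun i => cochar_vec R (e i)).

Lemma cone_evalE (a : 'I_r -> R) chi :
  (\sum_i a i *: cochar_vec R (e i) : V) chi = \sum_i a i * (e i chi)%:~R.
Proof. by rewrite homZ_sum. Qed.

Lemma cone_gen i : sigma (cochar_vec R (e i)).
Proof.
exists (fun j => (i == j)%:R) => [j|]; first exact: ler0n.
rewrite (bigD1 i) //= eqxx scale1r big1 ?addr0 // => j.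
by rewrite eq_sym => /negPf ->; rewrite scale0r.
Qed.

Lemma cone_dualP chi : dual_semigroup sigma chi <-> forall i, 0 <= e i chi.
Proof.
split=> [S i|h v [a a0 ->]].
  by have := S _ (cone_gen i); rewrite cochar_vecE ler0z.
by rewrite cone_evalE sumr_ge0 // => i _; rewrite mulr_ge0 // ler0z.
Qed.

Lemma cone_perpP chi : perp sigma chi <-> forall i, e i chi = 0.
Proof.
split=> [S i|h v [a a0 ->]].
  by have /eqP := S _ (cone_gen i); rewrite cochar_vecE intr_eq0 => /eqP.
by rewrite cone_evalE big1 // => i _; rewrite h mulr0.
Qed.

(** This says that the algebra of the face is the localization at [m]. A generator killed by [m]
    lies in [tau], where [chi] is already nonnegative; on any other one [m] is at least 1, so a
    multiple of [m] exceeding all the absolute values of [chi] suffices. Allowing every large [n]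
    lets several characters share one exponent. *)
Lemma cone_cuts_loc m tau chi : cuts m tau sigma -> dual_semigroup tau chi ->
  exists N, forall n, (N <= n)%N -> dual_semigroup sigma (chi + m *+ n).
Proof.
move=> [/cone_dualP Sm tauE] Schi.
exists (\sum_i `|e i chi|)%N => n Nn; apply/cone_dualP => i.
rewrite raddfD raddfMn.
have := Sm i; rewrite le_eqVlt => /predU1P[m0|m1].
  rewrite -m0 mul0rn addr0.
  have : tau (cochar_vec R (e i)).
    rewrite tauE; split; first exact: cone_gen.
    by rewrite /= -m0.
  by move/Schi; rewrite cochar_vecE ler0z.
apply: (@le_trans _ _ (e i chi + n%:Z)); last first.
  by rewrite lerD2l -[leLHS]natz lerMn2r -gtz0_ge1 m1 orbT.
apply: (@le_trans _ _ (e i chi + `|e i chi|%N%:Z)).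
  by rewrite abszE -lerBlDl sub0r -normrN ler_norm.
by rewrite lerD2l lez_nat (leq_trans _ Nn) // (bigD1 i) //= leq_addr.
Qed.

(** On a simplicial cone the zero locus of a nonnegative functional depends only on which generators
    it kills. The real values of [u] on the generators can thus be replaced by 0 and 1, and the
    [x i] realize these by a character. *)
Lemma cone_face_cuts tau : face tau sigma -> exists m, cuts m tau sigma.
Proof.
move=> [u [n [chi [a [_ uE]]]] [u0 ->]].
have uS (c : 'I_r -> R) : u (\sum_i c i *: cochar_vec R (e i)) =
    \sum_i c i * u (cochar_vec R (e i)).
  rewrite uE.
  under eq_bigr do rewrite cone_evalE.
  under eq_bigr do rewrite scaler_sumr.
  rewrite exchange_big; apply: eq_bigr => i _ /=.
  rewrite mulr_sumr; apply: eq_bigr => k _ /=.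
  by rewrite /GRing.scale /= mulrCA.
exists (\sum_(i | u (cochar_vec R (e i)) != 0) x i).
have em i : e i (\sum_(j | u (cochar_vec R (e j)) != 0) x j) =
    (u (cochar_vec R (e i)) != 0)%:R.
  rewrite raddf_sum; under eq_bigr do rewrite ex.
  have [h|h] := boolP (u (cochar_vec R (e i)) != 0).
    by rewrite (bigD1 i) //= eqxx big1 ?addr0 // => j /andP[_];
      rewrite eq_sym => /negPf ->.
  by rewrite big1 // => j hj; have [ij|//] := eqVneq i j;
    rewrite -ij (negPf h) in hj.
split; first by apply/cone_dualP => i; rewrite em ler0n.
apply/seteqP; split=> v [[c c0 ->]] /=; rewrite uS cone_evalE => s0.
  split; first by exists c.
  rewrite big1 // => i _; rewrite em.
  move/eqP: s0; rewrite psumr_eq0 => [/allP/(_ i)|j _]; last first.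
    by rewrite mulr_ge0 // u0 //; exact: cone_gen.
  rewrite mem_index_enum => /(_ isT)/implyP/(_ isT).
  by rewrite mulf_eq0 => /orP[/eqP ->|->]; rewrite ?mul0r ?mulr0.
split; first by exists c.
rewrite big1 // => i _.
move/eqP: s0; rewrite psumr_eq0 => [/allP/(_ i)|j _]; last first.
  by rewrite mulr_ge0 // em ler0z ler0n.
rewrite mem_index_enum => /(_ isT)/implyP/(_ isT); rewrite em.
rewrite mulf_eq0 => /orP[/eqP ->|]; first by rewrite mul0r.
by rewrite intr_eq0 pnatr_eq0 eqb0 negbK => /eqP ->; rewrite mulr0.
Qed.

End Coordinates.

Lemma smooth_coneP sigma : is_lattice X -> smooth_cone sigma ->
  exists r (e : 'I_r -> cochar X) (J : finType) x (y : J -> X) f,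
    adapted_basis e x y f /\ sigma = cone (fun i => cochar_vec R (e i)).
Proof.
move=> latX [r [e [freee splite ->]]].
have freeZ (c : 'I_r -> int) : \sum_i e i *~ c i = 0 -> forall i, c i = 0.
  move=> ec0 i; apply/eqP; rewrite -(intr_eq0 R); apply/eqP.
  apply: (freee (fun i => (c i)%:~R)) i; apply: homZ_ext => chi.
  rewrite homZ_sum -[RHS](_ : ((\sum_i e i *~ c i : cochar X) chi)%:~R = 0).
    rewrite homZ_sum rmorph_sum; apply: eq_bigr => i _ /=.
    by rewrite homZ_mulz /GRing.scale /= -intrM mulrzz mulrC.
  by rewrite ec0.
have [J [x [y [f b]]]] := adapted_basis_exists latX splite freeZ.
by exists r, e, J, x, y, f.
Qed.

End Cones.

Section Fan.
Variables (R : realType) (X : zmodType) (Delta : set (set (Vspace R X))).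
Hypotheses (latX : is_lattice X) (fanD : smooth_fan Delta).
Local Notation V := (Vspace R X).
Implicit Types (sigma tau rho : set V) (chi psi m : X).

Lemma fan_coneP sigma : Delta sigma ->
  exists r (e : 'I_r -> cochar X) (J : finType) x (y : J -> X) f,
    adapted_basis e x y f /\ sigma = cone (fun i => cochar_vec R (e i)).
Proof. by have [_ _ sm _ _] := fanD; move=> /sm; exact: smooth_coneP. Qed.

Lemma fan_face_cuts sigma tau : Delta sigma -> face tau sigma ->
  exists m, cuts m tau sigma.
Proof.
move=> /fan_coneP[r [e [J [x [y [f [[ex _ _ _ _] ->]]]]]]].
exact: cone_face_cuts.
Qed.

Lemma fan_cuts sigma tau : Delta sigma -> Delta tau ->
  exists m, cuts m (sigma `&` tau) tau.
Proof.
move=> Ds Dt; apply: fan_face_cuts => //.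
by have [_ _ _ _ /(_ _ _ Ds Dt)[]] := fanD.
Qed.

Lemma fan_setI sigma tau : Delta sigma -> Delta tau -> Delta (sigma `&` tau).
Proof.
move=> Ds Dt; have [_ _ _ fc /(_ _ _ Ds Dt)[fs _]] := fanD.
exact: fc fs.
Qed.

Lemma fan_cuts_mem sigma tau m : Delta sigma -> cuts m tau sigma -> Delta tau.
Proof. by move=> Ds /cuts_face; have [_ _ _ fc _] := fanD; exact: fc. Qed.

Lemma fan_sub_cuts sigma tau : Delta sigma -> Delta tau -> tau `<=` sigma ->
  exists m, cuts m tau sigma.
Proof.
by move=> Ds Dt ts; rewrite -[tau](setIidl ts); exact: fan_cuts.
Qed.

Lemma fan_cuts_loc sigma m tau chi : Delta sigma -> cuts m tau sigma ->
  dual_semigroup tau chi ->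
  exists N, forall n, (N <= n)%N -> dual_semigroup sigma (chi + m *+ n).
Proof.
move=> /fan_coneP[r [e [J [x [y [f [[ex _ _ _ _] ->]]]]]]].
exact: cone_cuts_loc.
Qed.

End Fan.

(** * Charts and their gluing *)

Lemma torus_neq0 (R : realType) (X : zmodType) (t : torus R X) chi : t chi != 0.
Proof.
have := oner_neq0 R[i]; rewrite -(torus0 t) -(subrr chi) torusD.
by rewrite mulf_eq0 negb_or => /andP[].
Qed.

Section Charts.
Variables (R : realType) (X : zmodType).
Local Notation V := (Vspace R X).
Local Notation C := R[i].
Implicit Types (sigma tau rho : set V) (chi psi m : X).

Lemma chart_ext sigma (p q : chart sigma) :
  (forall chi, dual_semigroup sigma chi -> p chi = q chi) -> p = q.
Proof.
move=> pq; have {}pq : chart_fun p = chart_fun q.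
  apply/funext => chi; have [/pq//|nS] := pselect (dual_semigroup sigma chi).
  by rewrite !chart_out.
case: p q pq => [p p0 pD pO] [q q0 qD qO] /= pq; subst q.
by congr Chart; exact: Prop_irrelevance.
Qed.

Lemma chart_mk sigma (g : X -> C) : g 0 = 1 ->
  (forall chi psi, dual_semigroup sigma chi -> dual_semigroup sigma psi ->
    g (chi + psi) = g chi * g psi) ->
  exists p : chart sigma, forall chi, dual_semigroup sigma chi -> p chi = g chi.
Proof.
move=> g0 gD; pose h chi := if `[< dual_semigroup sigma chi >] then g chi else
  0.
have hE chi : dual_semigroup sigma chi -> h chi = g chi.
  by rewrite /h; case: asboolP.
have h0 : h 0 = 1 by rewrite hE //; exact: dual_semigroup0.
have hD chi psi : dual_semigroup sigma chi -> dual_semigroup sigma psi ->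
    h (chi + psi) = h chi * h psi.
  by move=> Sc Sp; rewrite !hE ?gD //; exact: dual_semigroupD.
have hO chi : ~ dual_semigroup sigma chi -> h chi = 0.
  by rewrite /h; case: asboolP.
by exists (Chart h0 hD hO).
Qed.

Lemma chart_restrict sigma tau (r : chart tau) : tau `<=` sigma ->
  exists p : chart sigma, forall chi, dual_semigroup sigma chi -> p chi = r chi.
Proof.
move=> /sub_dual_semigroup S; apply: chart_mk => [|chi psi /S Sc /S Sp].
  exact: chart0.
exact: chartD.
Qed.

Lemma chartMn sigma (p : chart sigma) chi n :
  dual_semigroup sigma chi -> p (chi *+ n) = p chi ^+ n.
Proof.
move=> S; elim: n => [|n IHn]; first by rewrite mulr0n chart0.
by rewrite mulrS exprS chartD ?IHn //; exact: dual_semigroupMn.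
Qed.

Lemma chart_neq0 sigma (p : chart sigma) chi : dual_semigroup sigma chi ->
  dual_semigroup sigma (- chi) -> p chi != 0.
Proof.
move=> S SN; have : p (chi + - chi) != 0 by rewrite subrr chart0 oner_neq0.
by rewrite chartD // mulf_eq0 negb_or => /andP[].
Qed.

Lemma chart_cut_neq0 sigma tau m (r : chart tau) : cuts m tau sigma -> r m != 0.
Proof.
by move=> cm; apply: chart_neq0; [exact: cuts_dual cm|exact: cuts_dualN cm].
Qed.

End Charts.

Section Glueing.
Variables (R : realType) (X : zmodType) (Delta : set (set (Vspace R X))).
Hypotheses (latX : is_lattice X) (fanD : smooth_fan Delta).
Local Notation V := (Vspace R X).
Local Notation C := R[i].
Implicit Types (sigma tau rho : set V) (chi psi m : X).

(** The extension to a character of [tau] is forced: add a multiple of [m] to reach the dual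
    semigroup of [sigma], evaluate [p], and divide by the same power of [p m]. *)
Lemma chart_extend sigma tau m (p : chart sigma) :
  Delta sigma -> cuts m tau sigma -> p m != 0 ->
  exists r : chart tau, forall chi, dual_semigroup sigma chi -> r chi = p chi.
Proof.
move=> Ds cm pm; have Sm := cm.1.
(* The value is required to work for all admissible [n] at once, so that the values at [chi], [psi]
   and their sum can be compared with different exponents. *)
have g_ chi : exists c, dual_semigroup tau chi -> forall n,
    dual_semigroup sigma (chi + m *+ n) -> p (chi + m *+ n) = c * p m ^+ n.
  have [Sc|] := pselect (dual_semigroup tau chi); last by exists 0.
  have [N HN] := fan_cuts_loc latX fanD Ds cm Sc.
  exists (p (chi + m *+ N) / p m ^+ N) => _ n Sn.
  apply: (mulIf (expf_neq0 N pm)); rewrite mulrAC divfK ?expf_neq0 //.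
  rewrite -!chartMn // -!chartD //; first last.
  - exact: dual_semigroupMn.
  - exact: dual_semigroupMn.
  - exact: HN.
  by rewrite addrAC.
have [g gP] := choice g_.
have gE chi : dual_semigroup sigma chi -> g chi = p chi.
  move=> Sc; have St := sub_dual_semigroup (cuts_sub cm) Sc.
  by have := gP _ St 0%N; rewrite mulr0n addr0 expr0 mulr1 => ->.
have [|chi psi Sc Sp|r rE] := @chart_mk _ _ tau g.
- by rewrite gE ?chart0 //; exact: dual_semigroup0.
- have [N HN] := fan_cuts_loc latX fanD Ds cm Sc.
  have [M HM] := fan_cuts_loc latX fanD Ds cm Sp.
  have E : chi + psi + m *+ (N + M) = (chi + m *+ N) + (psi + m *+ M).
    by rewrite mulrnDr addrACA.
  have SN := HN _ (leqnn N); have SM := HM _ (leqnn M).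
  apply: (mulIf (expf_neq0 (N + M) pm)).
  rewrite -gP ?E; [|exact: dual_semigroupD|exact: dual_semigroupD].
  by rewrite chartD // (gP _ Sc) // (gP _ Sp) // exprD mulrACA.
exists r => chi Sc; rewrite rE ?gE //.
exact: sub_dual_semigroup (cuts_sub cm) _ Sc.
Qed.

(** Every character of [tau] becomes one of [sigma] after adding a multiple of [m], which is
    invertible on the smaller chart. *)
Lemma chart_extend_uniq sigma tau (r r' : chart tau) :
  Delta sigma -> Delta tau -> tau `<=` sigma ->
  (forall chi, dual_semigroup sigma chi -> r chi = r' chi) -> r = r'.
Proof.
move=> Ds Dt ts rr'; have [m cm] := fan_sub_cuts latX fanD Ds Dt ts.
apply: chart_ext => chi Sc.
have [N HN] := fan_cuts_loc latX fanD Ds cm Sc.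
have Sm := cuts_dual cm; have SmN := dual_semigroupMn N Sm.
have := rr' _ (HN _ (leqnn N)); rewrite !chartD // !chartMn // (rr' m cm.1).
by apply: mulIf; rewrite expf_neq0 // (chart_cut_neq0 _ cm).
Qed.

(* This relation is already transitive: inside [U_sigma], the open subsets
   [U_rho] and [U_rho'] meet in [U_(rho `&` rho')]. *)
Definition overlap (x y : atlas Delta) : Prop :=
  exists rho (r : chart rho), [/\ Delta rho,
    rho `<=` set_val (tag x), rho `<=` set_val (tag y),
    forall chi, dual_semigroup (set_val (tag x)) chi ->
      (tagged x : chart _) chi = r chi &
    forall chi, dual_semigroup (set_val (tag y)) chi ->
      (tagged y : chart _) chi = r chi].

Lemma glue_overlap (x y : atlas Delta) : Defs.glue x y <-> overlap x y.
Proof.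
split=> [/asboolP|[rho [r [Dr rx ry xr yr]]]]; last first.
  pose z : atlas Delta :=
    existT (fun s : set_type Delta => chart_space (set_val s))
      (exist _ rho (mem_set Dr)) r.
  apply/asboolP; apply: (rst_trans _ _ _ z); first exact/rst_step.
  exact/rst_sym/rst_step.
elim=> {x y} [x y [yx xy]|x|x y _ [rho [r []]]|x y z].
- by exists (set_val (tag y)), (tagged y); split=> //; exact: set_valP.
- by exists (set_val (tag x)), (tagged x); split=> //; exact: set_valP.
- by exists rho, r.
move=> _ [rho [r [Dr rx ry xr yr]]] _ [rho' [r' [Dr' ry' rz yr' zr']]].
have Dy : Delta (set_val (tag y)) := set_valP _.
have [m cm] := fan_sub_cuts latX fanD Dy Dr ry.
have [m' cm'] := fan_sub_cuts latX fanD Dy Dr' ry'.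
have [Sm Sm'] := (cm.1, cm'.1).
(* The point of [y] lies in the charts of [rho] and of [rho'], so neither [m] nor [m'] vanishes
   there; hence their sum does not either, and the point extends to the intersection. *)
have cmm := cutsI cm cm'.
have [|s sE] := @chart_extend _ _ _ (tagged y) Dy cmm.
  rewrite chartD //; apply: mulf_neq0.
    by rewrite yr //; exact: chart_cut_neq0 cm.
  by rewrite yr' //; exact: chart_cut_neq0 cm'.
have Drr := fan_setI fanD Dr Dr'.
have sr chi : dual_semigroup rho chi -> r chi = s chi.
  have [q qE] := chart_restrict s (@subIsetl _ rho rho').
  rewrite (@chart_extend_uniq _ _ r q Dy Dr ry) => [/qE//|psi Sp].
  by rewrite qE ?sE ?yr //; exact: sub_dual_semigroup ry _ Sp.
have sr' chi : dual_semigroup rho' chi -> r' chi = s chi.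
  have [q qE] := chart_restrict s (@subIsetr _ rho rho').
  rewrite (@chart_extend_uniq _ _ r' q Dy Dr' ry') => [/qE//|psi Sp].
  by rewrite qE ?sE ?yr' //; exact: sub_dual_semigroup ry' _ Sp.
exists (rho `&` rho'), s; split=> //.
- by move=> v [/rx].
- by move=> v [_ /rz].
- by move=> chi Sx; rewrite xr // sr //; exact: sub_dual_semigroup rx _ Sx.
by move=> chi Sz; rewrite zr' // sr' //; exact: sub_dual_semigroup rz _ Sz.
Qed.

Lemma toric_pi_eqP (s t : set_type Delta) (p : chart (set_val s))
    (q : chart (set_val t)) :
  toric_pi p = toric_pi q <-> exists r : chart (set_val s `&` set_val t),
    (forall chi, dual_semigroup (set_val s) chi -> p chi = r chi) /\
    (forall chi, dual_semigroup (set_val t) chi -> q chi = r chi).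
Proof.
rewrite /toric_pi; split=> [/eqmodP/glue_overlap[rho [r [Dr /= rs rt pr
  qr]]]|[r [pr qr]]].
  have rst : rho `<=` set_val s `&` set_val t by move=> v rv; split; auto.
  have [r' r'E] := chart_restrict r rst.
  exists r'; split=> chi S.
    by rewrite pr // r'E //; exact: sub_dual_semigroup (@subIsetl _ _ _) _ S.
  by rewrite qr // r'E //; exact: sub_dual_semigroup (@subIsetr _ _ _) _ S.
apply/eqmodP/glue_overlap.
exists (set_val s `&` set_val t), r; split=> //=.
exact: (fan_setI fanD (set_valP s) (set_valP t)).
Qed.

Lemma toric_pi_inj (s : set_type Delta) : injective (@toric_pi R X Delta s).
Proof.
move=> p q /toric_pi_eqP[r [pr qr]]; apply: chart_ext => chi S.
by rewrite pr // qr.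
Qed.

Lemma toric_pi_surj (x : toric_variety Delta) :
  exists (s : set_type Delta) (p : chart (set_val s)), x = toric_pi p.
Proof.
exists (tag (toric_repr x)), (tagged (toric_repr x)).
by rewrite /toric_pi /toric_repr; case: (repr _) (reprK x) => s p /= <-.
Qed.

Lemma toric_act_pi (h : torus R X) (s : set_type Delta) (p : chart (set_val s))
    :
  toric_act h (toric_pi p) = toric_pi (chart_act h p).
Proof.
rewrite /toric_act; set x := toric_repr _.
have : toric_pi (tagged x : chart _) = toric_pi p.
  by rewrite -[RHS](reprK (toric_pi p)) /toric_pi /x /toric_repr;
    case: (repr _).
move=> /toric_pi_eqP[r [xr pr]]; apply/toric_pi_eqP; exists (chart_act h r).
by split=> chi S /=; rewrite ?xr ?pr.
Qed.

Lemma affine_open_pi (s : set_type Delta) (p : chart (set_val s)) :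
  affine_open (set_val s) (toric_pi p).
Proof. by exists s, p. Qed.

Lemma affine_openP (s : set_type Delta) (x : toric_variety Delta) :
  affine_open (set_val s) x -> exists p : chart (set_val s), x = toric_pi p.
Proof. by move=> [t [p [/val_inj ts ->]]]; subst t; exists p. Qed.

Lemma cut_affine_open (s t : set_type Delta) m (q : chart (set_val t)) :
  cuts m (set_val s `&` set_val t) (set_val t) ->
  q m != 0 <-> affine_open (set_val s) (toric_pi q).
Proof.
move=> cm; split=> [qm|/affine_openP[p] /toric_pi_eqP[r [qr pr]]]; last first.
  rewrite setIC in cm.
  by rewrite qr ?(chart_cut_neq0 _ cm) //; exact: cm.1.
have [r rq] := chart_extend (set_valP t) cm qm.
have [p pr] := chart_restrict r (@subIsetl _ _ _).
by exists s, p; split=> //; apply/esym/toric_pi_eqP; exists r;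
  split=> // chi /rq.
Qed.

End Glueing.

(** * Topology and regular functions *)

Lemma continuous_open (S T : topologicalType) (f : S -> T) (A : set T) :
  continuous f -> open A -> open (f @^-1` A).
Proof. by move=> /continuousP; apply. Qed.

Section SheafLike.
Variable K : fieldType.
Implicit Types (Y Z U : funspace K).

Definition in_sub Y (B : set Y) (x : Y) (Bx : B x) : fs_sub B :=
  exist (fun y => y \in B) x (mem_set Bx).

(** The record [funspace] imposes no axiom on [regular]; this gluing condition also yields
    restriction to smaller sets. *)
Definition fs_local Y := forall (W : set Y) (f : Y -> K),
  (forall x, W x -> exists (W' : set Y) (g : Y -> K),
    [/\ open W', W' x, regular W' g & forall y, W y -> W' y -> f y = g y]) ->
  regular W f.

Lemma fs_local_subset Y (W W' : set Y) f : fs_local Y -> open W ->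
  regular W f -> W' `<=` W -> regular W' f.
Proof. by move=> locY oW rf sW; apply: locY => x /sW Wx; exists W, f. Qed.

Lemma fs_sub_openP Y (B : set Y) (W : set (fs_sub B)) :
  open W <-> exists2 A : set Y, open A & W = (fun x : fs_sub B => set_val x)
    @^-1` A.
Proof. by split=> [[A oA <-]|[A oA ->]]; exists A. Qed.

Lemma fs_sub_local Y (B : set Y) : fs_local Y -> fs_local (fs_sub B).
Proof.
move=> locY W f Wf x Wx; have [W' [g [/fs_sub_openP[A oA ->] Ax rg fg]]] := Wf
  x Wx.
have [V [h [oV Vx rh gh]]] := rg x Ax.
exists (A `&` V), h; split=> //; first exact: openI.
  by apply: fs_local_subset rh _ => // y [].
by move=> y Wy [Ay Vy]; rewrite fg // gh.
Qed.

Lemma fs_morphism_comp Y Z U (f : Y -> Z) (g : Z -> U) :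
  fs_morphism f -> fs_morphism g -> fs_morphism (g \o f).
Proof.
move=> [cf rf] [cg rg]; split=> [x|W h oW rh].
  by apply: continuous_comp; [exact: cf|exact: cg].
exact: (rf _ _ (continuous_open cg oW) (rg _ _ oW rh)).
Qed.

Lemma fs_iso_comp Y Z U (f : Y -> Z) (g : Z -> U) :
  fs_iso f -> fs_iso g -> fs_iso (g \o f).
Proof.
move=> [f' [ff' f'f mf mf']] [g' [gg' g'g mg mg']]; exists (f' \o g'); split.
- exact: can_comp.
- exact: can_comp.
- exact: fs_morphism_comp.
- exact: fs_morphism_comp.
Qed.

Lemma fs_sub_val_morphism Y (B : set Y) :
  fs_morphism (fun x : fs_sub B => set_val x : Y).
Proof.
split; first by apply/continuousP => A oA; apply/fs_sub_openP; exists A.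
by move=> W g oW rg x /= Wx; exists W, g.
Qed.

Lemma fs_morphism_to_sub Y Z (B : set Z) (f : Y -> fs_sub B) : fs_local Y ->
  fs_morphism (fun y => set_val (f y) : Z) -> fs_morphism f.
Proof.
move=> locY [cf rf]; split.
  apply/continuousP => _ /fs_sub_openP[A oA ->].
  exact: (continuous_open cf oA).
move=> W g oW rg; apply: locY => y /rg[W' [h [oW' W'y rh gh]]].
exists ((fun y => set_val (f y)) @^-1` W'), (fun y => h (set_val (f y))).
split=> //; first exact: (continuous_open cf oW').
  exact: (rf W' h).
by move=> z Wz W'z /=; apply: gh.
Qed.

Lemma fs_morphism_from_sub Y Z (B : set Y) (f : fs_sub B -> Z) :
  (forall (W : set Z), open W -> forall x : fs_sub B, W (f x) ->
    exists2 A : set Y, open A /\ A (set_val x) &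
      forall y : fs_sub B, A (set_val y) -> W (f y)) ->
  (forall (W : set Z) g, open W -> regular W g -> forall x : fs_sub B, W (f x)
    ->
    exists (A : set Y) (h : Y -> K), [/\ open A, A (set_val x), regular A h &
      forall y : fs_sub B, W (f y) -> A (set_val y) -> g (f y) = h (set_val
        y)]) ->
  fs_morphism f.
Proof.
move=> fo fr; split; last by move=> W g oW rg x /= Wx; exact: fr Wx.
apply/continuousP => W oW; rewrite openE => x /= Wfx.
have [A [oA Ax] AW] := fo W oW x Wfx.
rewrite /interior nbhsE; exists ((fun x : fs_sub B => set_val x) @^-1` A) => //.
by split=> //; apply/fs_sub_openP; exists A.
Qed.

Lemma fs_iso_preimage Y Z (f : Y -> Z) (W : set Z) : fs_local Y -> fs_local Z ->
  fs_iso f -> exists g : fs_sub (f @^-1` W) -> fs_sub W, fs_iso g.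
Proof.
move=> locY locZ [f' [ff' f'f mf mf']].
have fW (y : fs_sub (f @^-1` W)) : W (f (set_val y)).
  exact: (set_valP y).
have f'W (z : fs_sub W) : (f @^-1` W) (f' (set_val z)).
  by rewrite /= f'f; exact: (set_valP z).
exists (fun y => in_sub (fW y)), (fun z => in_sub (f'W z)); split.
- by move=> y; apply: val_inj; exact: ff'.
- by move=> y; apply: val_inj; exact: f'f.
- apply: fs_morphism_to_sub; first exact: fs_sub_local.
  exact: (fs_morphism_comp (@fs_sub_val_morphism _ _) mf).
- apply: fs_morphism_to_sub; first exact: fs_sub_local.
  exact: (fs_morphism_comp (@fs_sub_val_morphism _ _) mf').
Qed.

Lemma fs_iso_smooth Y Z (f : Y -> Z) : fs_local Y -> fs_local Z ->
  fs_iso f -> smooth_variety Z -> smooth_variety Y.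
Proof.
move=> locY locZ isof smZ y.
have [W [oW Wfy [N [k [g [h [rk [u isou]]]]]]]] := smZ (f y).
have [_ [_ _ [cf _] _]] := isof.
exists (f @^-1` W); split=> //; first exact: (continuous_open cf oW).
exists N, k, g, h => /=; split; first exact: rk.
have [v isov] := fs_iso_preimage W locY locZ isof.
by exists (u \o v); exact: fs_iso_comp isov isou.
Qed.

Lemma zariski_local (P : choiceType) (A : fun_algebra K P) :
  fs_local (zariski_space A).
Proof.
move=> W f Wf p Wp; have [W' [g [oW' W'p rg fg]]] := Wf p Wp.
have [a [b [Aa Ab bp gab]]] := rg p W'p.
have [c [Ac cp cW']] := (oW' : zariski_open W') p W'p.
exists (fun q => a q * c q), (fun q => b q * c q); split.
- exact: algfunM.
- exact: algfunM.
- by rewrite mulf_neq0.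
move=> q Wq; rewrite mulf_eq0 negb_or => /andP[bq cq].
by rewrite fg ?gab -?mulf_div ?divff ?mulr1 //; exact: cW'.
Qed.

End SheafLike.

Section ToricTopology.
Variables (R : realType) (X : zmodType) (Delta : set (set (Vspace R X))).
Hypotheses (latX : is_lattice X) (fanD : smooth_fan Delta).
Local Notation V := (Vspace R X).
Local Notation C := R[i].
Local Notation K := (toric_variety Delta).
Implicit Types (sigma tau rho : set V) (chi psi m : X) (s t : set_type Delta).

Lemma toric_openP (W : set K) : open W <->
  forall s, open (@toric_pi R X Delta s @^-1` W : set (chart_space (set_val
    s))).
Proof.
split=> [oW s|oW].
  have /sigT_openP := oW : open (\pi_({eq_quot glue_equiv Delta}) @^-1` W).
  exact.
suff : open (\pi_({eq_quot glue_equiv Delta}) @^-1` W) by [].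
by apply/sigT_openP => s; exact: oW.
Qed.

Lemma toric_local : fs_local K.
Proof.
move=> W f Wf s; apply: zariski_local => p /Wf[W' [g [oW' W'p rg fg]]].
exists (@toric_pi R X Delta s @^-1` W'), (g \o @toric_pi R X Delta s);
  split=> //.
- exact: (toric_openP W').1.
- exact: rg.
- by move=> q /= Wq W'q; exact: fg.
Qed.

Lemma toric_pi_morphism s :
  @fs_morphism _ (chart_space (set_val s)) K (@toric_pi R X Delta s).
Proof.
split; first by apply/continuousP => W /toric_openP; exact.
by move=> W g oW rg; exact: rg.
Qed.

(* [m] is invertible on [U_(sigma `&` tau)], whose functions become regular on
   [U_tau] after multiplication by a power of [m]. *)
Lemma chart_fun_transfer s t m a :
  cuts m (set_val s `&` set_val t) (set_val t) ->
  chart_algebra (set_val s) a ->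
  exists N0, forall N, (N0 <= N)%N ->
    exists2 b, chart_algebra (set_val t) b & forall p q,
      @toric_pi _ _ Delta s p = @toric_pi _ _ Delta t q -> b q = q m ^+ N * a p.
Proof.
move=> cm [n [c [chi [Schi ->]]]].
have Srho k : dual_semigroup (set_val s `&` set_val t) (chi k).
  exact: sub_dual_semigroup (@subIsetl _ _ _) _ (Schi k).
have [N HN] := choice (fun k => fan_cuts_loc latX fanD (set_valP t) cm (Srho
  k)).
exists (\sum_k N k)%N => M NM.
have S k : dual_semigroup (set_val t) (chi k + m *+ M).
  by apply: HN; rewrite (leq_trans _ NM) // (bigD1 k) //= leq_addr.
exists (fun q => \sum_k c k * q (chi k + m *+ M)).
  by exists n, c, (fun k => chi k + m *+ M).
move=> p q /(toric_pi_eqP latX fanD)[r [pr qr]].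
rewrite mulr_sumr; apply: eq_bigr => k _; rewrite qr // chartD //; last first.
  by apply: dual_semigroupMn; exact: cuts_dual cm.
rewrite chartMn; last exact: cuts_dual cm.
by rewrite pr // qr ?mulrA 1?mulrC ?mulrA //; exact: cm.1.
Qed.

Lemma mono_algfun sigma chi : dual_semigroup sigma chi ->
  chart_algebra sigma (fun p => p chi).
Proof.
move=> S; exists 1%N, (fun=> 1), (fun=> chi); split=> //.
by apply/funext => p; rewrite big_ord1 mul1r.
Qed.

Lemma toric_pi_open s (W : set (chart_space (set_val s))) : open W ->
  open (@toric_pi R X Delta s @` W : set K).
Proof.
move=> oW; apply/toric_openP => t.
suff : zariski_open (A := chart_algebra (set_val t))
  (@toric_pi R X Delta t @^-1` (@toric_pi R X Delta s @` W)) by [].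
move=> q [p Wp pq].
have [a [Aa ap aW]] := (oW : zariski_open W) p Wp.
have [m cm] := fan_cuts latX fanD (set_valP s) (set_valP t).
have [N /(_ N (leqnn N))[b Ab bE]] := chart_fun_transfer cm Aa.
have qU : q m != 0.
  apply/(cut_affine_open latX fanD q cm); rewrite -pq; exact: affine_open_pi.
(* The factor [q m] confines the basic open set to the intersection of the two charts, where [b] is
   [a] times a unit. *)
exists (fun q : chart (set_val t) => q m * b q); split.
- by apply: algfunM => //; apply: mono_algfun; exact: cm.1.
- by rewrite mulf_neq0 // (bE p) // mulf_neq0 // expf_neq0.
move=> q'; rewrite mulf_eq0 negb_or => /andP[q'm bq'].
have /(affine_openP)[p' qp'] := (cut_affine_open latX fanD q' cm).1 q'm.
exists p' => //; apply: aW; move: bq'.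
by rewrite (bE p') // mulf_eq0 negb_or => /andP[].
Qed.

Lemma toric_pi_regular s (W : set (chart_space (set_val s))) f (g : K -> C) :
  open W -> regular W f -> (forall p, W p -> g (toric_pi p) = f p) ->
  regular (@toric_pi R X Delta s @` W : set K) g.
Proof.
move=> oW rf fg t q [p Wp pq].
have [a [b [Aa Ab bp fE]]] := rf p Wp.
have [m cm] := fan_cuts latX fanD (set_valP s) (set_valP t).
have [Na HNa] := chart_fun_transfer cm Aa.
have [Nb HNb] := chart_fun_transfer cm Ab.
(* Numerator and denominator get the same exponent, so that the powers of [m] cancel in the
   quotient. *)
have [a' Aa' aE] := HNa (Na + Nb)%N (leq_addr _ _).
have [b' Ab' bE] := HNb (Na + Nb)%N (leq_addl _ _).
have q0 : q m != 0.
  apply/(cut_affine_open latX fanD q cm); rewrite -pq; exact: affine_open_pi.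
exists (fun q : chart (set_val t) => q m * a' q).
exists (fun q : chart (set_val t) => q m * b' q); split.
- by apply: algfunM => //; apply: mono_algfun; exact: cm.1.
- by apply: algfunM => //; apply: mono_algfun; exact: cm.1.
- by rewrite (bE p) // !mulf_neq0 // expf_neq0.
move=> q' [p' Wp' p'q']; rewrite (aE p') // (bE p') //= -p'q' fg //.
rewrite !mulf_eq0 !negb_or => /and3P[q'm _ bp'].
rewrite fE // !mulrA -[RHS]mulf_div divff ?mul1r //.
by rewrite mulf_neq0 // expf_neq0.
Qed.

Lemma toric_pi_iso s : exists f : fs_sub (range (@toric_pi R X Delta s) : set
    K) ->
  chart_space (set_val s), fs_iso f.
Proof.
set U : set K := range _; pose i (p : chart_space (set_val s)) : K := toric_pi
  p.
have inj : injective i := toric_pi_inj latX fanD (s := s).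
have iU p : U (i p) by exists p.
have f_ (x : fs_sub U) : exists p, i p = set_val x.
  by have [p _ px] := set_valP x; exists p.
have [f fE] := choice f_.
exists f, (fun p => in_sub (iU p)); split.
- by move=> x; apply: val_inj => /=; rewrite fE.
- by move=> p; apply: inj; rewrite fE.
- apply: fs_morphism_from_sub => [W oW x Wx|W g oW rg x Wx].
    exists (i @` W); first by split; [exact: toric_pi_open|exists (f x)].
    by move=> y [p Wp]; rewrite -fE => /inj <-.
  (* A regular function on a subset is a restriction of one on the ambient space; [g] is extended
     outside the chart by the arbitrary value 0. *)
  have h_ (y : K) : exists c : C, forall p, i p = y -> c = g p.
    have [[p <-]|npy] := pselect (exists p, i p = y).
      by exists (g p) => q /inj ->.
    by exists 0 => p py; case: npy; exists p.
  have [h hE] := choice h_.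
  exists (i @` W), h; split.
  - exact: toric_pi_open.
  - by exists (f x).
  - by apply: toric_pi_regular oW rg _ => p Wp; apply: hE.
  - by move=> y Wy _; rewrite (hE _ (f y)).
- apply: fs_morphism_to_sub; first exact: zariski_local.
  exact: toric_pi_morphism.
Qed.

End ToricTopology.

(** * Coordinates on a chart *)

Section Coordinates.
Variables (R : realType) (X : zmodType).
Local Notation V := (Vspace R X).
Local Notation C := R[i].
Variables (r : nat) (e : 'I_r -> cochar X) (J : finType).
Variables (x : 'I_r -> X) (y : J -> X) (f : J -> cochar X).
Hypothesis adapted : adapted_basis e x y f.
Let sigma : set V := cone (fun i => cochar_vec R (e i)).

Let ex i j : e i (x j) = (i == j)%:R. Proof. by case: adapted. Qed.
Let ey i k : e i (y k) = 0. Proof. by case: adapted. Qed.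
Let fx k i : f k (x i) = 0. Proof. by case: adapted. Qed.
Let fy k l : f k (y l) = (k == l)%:R. Proof. by case: adapted. Qed.
Let xy chi : chi = \sum_i x i *~ e i chi + \sum_k y k *~ f k chi.
Proof. by case: adapted. Qed.

(** The character [chi] as a Laurent monomial in the coordinates. Since a [z i] may be 0,
    multiplicativity in [chi] needs nonnegative exponents on it, hence the dual semigroup; the [w k]
    are kept nonzero. *)
Definition monomial (z : 'I_r -> C) (w : J -> C) (chi : X) : C :=
  (\prod_i z i ^ e i chi) * \prod_k w k ^ f k chi.

Lemma monomial0 z w : monomial z w 0 = 1.
Proof. by rewrite /monomial !big1 ?mulr1 // => i _; rewrite raddf0 expr0z. Qed.

Lemma exprzD_ge0 (a : C) (m n : int) : 0 <= m -> 0 <= n ->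
  a ^ (m + n) = a ^ m * a ^ n.
Proof. by case: m n => // m [] // n _ _; rewrite -PoszD -!exprnP exprD. Qed.

Lemma monomialD z w chi psi : (forall k, w k != 0) ->
  dual_semigroup sigma chi -> dual_semigroup sigma psi ->
  monomial z w (chi + psi) = monomial z w chi * monomial z w psi.
Proof.
move=> w0 /cone_dualP Sc /cone_dualP Sp.
rewrite /monomial mulrACA -!big_split /=; congr (_ * _); apply: eq_bigr => i _.
  by rewrite raddfD exprzD_ge0.
by rewrite raddfD expfzDr.
Qed.

Lemma monomialD_neq0 z w chi psi : (forall i, z i != 0) -> (forall k, w k != 0)
    ->
  monomial z w (chi + psi) = monomial z w chi * monomial z w psi.
Proof.
move=> z0 w0; rewrite /monomial mulrACA -!big_split /=.
by congr (_ * _); apply: eq_bigr => i _; rewrite raddfD expfzDr.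
Qed.

Lemma torus_mk z w : (forall i, z i != 0) -> (forall k, w k != 0) ->
  exists t : torus R X, forall chi, t chi = monomial z w chi.
Proof.
move=> z0 w0; have D chi psi := @monomialD_neq0 z w chi psi z0 w0.
by exists (Torus (monomial0 z w) D).
Qed.

Lemma chart_monomial_mk z w : (forall k, w k != 0) ->
  exists p : chart sigma, forall chi, dual_semigroup sigma chi ->
    p chi = monomial z w chi.
Proof.
move=> w0; apply: chart_mk; first exact: monomial0.
by move=> chi psi; exact: monomialD.
Qed.

Lemma dual_x i : dual_semigroup sigma (x i).
Proof. by apply/cone_dualP => j; rewrite ex ler0n. Qed.

Lemma perp_y k : perp sigma (y k).
Proof. by apply/cone_perpP => j; rewrite ey. Qed.

Lemma monomial_x z w i : monomial z w (x i) = z i.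
Proof.
rewrite /monomial (bigD1 i) //= ex eqxx expr1z !big1 ?mulr1 //.
  by move=> k _; rewrite fx expr0z.
by move=> j /negPf ji; rewrite ex ji expr0z.
Qed.

Lemma monomial_y z w k : monomial z w (y k) = w k.
Proof.
rewrite /monomial mulrC (bigD1 k) //= fy eqxx expr1z !big1 ?mulr1 //.
  by move=> i _; rewrite ey expr0z.
by move=> j /negPf ji; rewrite fy ji expr0z.
Qed.

Lemma chart_y_neq0 (p : chart sigma) k : p (y k) != 0.
Proof.
by apply: chart_neq0; [|rewrite -[- _]/(- _)]; apply: perp_dual;
  [|apply: perpN]; exact: perp_y.
Qed.

Lemma chart_sum (p : chart sigma) (I : finType) (u : I -> X) :
  (forall i, dual_semigroup sigma (u i)) -> p (\sum_i u i) = \prod_i p (u i).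
Proof.
move=> Su; suff [] : dual_semigroup sigma (\sum_i u i) /\
  p (\sum_i u i) = \prod_i p (u i) by [].
elim/big_rec2: _ => [|i b a _ [Sa pa]].
  by rewrite chart0; split=> //; exact: dual_semigroup0.
by rewrite chartD // pa; split=> //; exact: dual_semigroupD.
Qed.

Lemma dual_mulz_perp chi n : perp sigma chi -> dual_semigroup sigma (chi *~ n).
Proof. by move=> h v sv; rewrite raddfMz h // mul0rz. Qed.

Lemma chart_mulz_perp (p : chart sigma) chi n : perp sigma chi ->
  p (chi *~ n) = p chi ^ n.
Proof.
move=> h; have S := perp_dual h; have SN := perp_dual (perpN h).
case: n => n; first by rewrite -pmulrn chartMn.
rewrite NegzE mulrNz -exprnN -pmulrn -mulNrn chartMn // -exprVn; congr (_ ^+ _).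
have p0 := chart_neq0 p S SN.
by apply: (mulfI p0); rewrite -chartD // subrr chart0 divff.
Qed.

Lemma chart_monomialE (p : chart sigma) chi : dual_semigroup sigma chi ->
  p chi = monomial (p \o x) (p \o y) chi.
Proof.
move=> /cone_dualP Sc; rewrite {1}(xy chi) chartD; first last.
- by elim/big_rec: _ => [|k u _ Su]; [exact: dual_semigroup0|];
    apply: dual_semigroupD => //; apply: dual_mulz_perp; exact: perp_y.
- elim/big_rec: _ => [|i u _ Su]; first exact: dual_semigroup0.
  apply: dual_semigroupD => //; case: (e i chi) (Sc i) => // n _.
  by rewrite -pmulrn; apply: dual_semigroupMn; exact: dual_x.
rewrite !chart_sum.
- congr (_ * _); apply: eq_bigr => i _ /=.
    by case: (e i chi) (Sc i) => // n _; rewrite -pmulrn chartMn //;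
      exact: dual_x.
  by rewrite chart_mulz_perp //; exact: perp_y.
- by move=> k; apply: dual_mulz_perp; exact: perp_y.
- move=> i; case: (e i chi) (Sc i) => // n _.
  by rewrite -pmulrn; apply: dual_semigroupMn; exact: dual_x.
Qed.

Lemma monomial_perp z z' w chi : perp sigma chi ->
  monomial z w chi = monomial z' w chi.
Proof.
move=> /cone_perpP h; congr (_ * _).
by rewrite !big1 // => i _; rewrite h expr0z.
Qed.

Lemma monomial_z0 w chi : dual_semigroup sigma chi -> ~ perp sigma chi ->
  monomial (fun=> 0) w chi = 0.
Proof.
move=> /cone_dualP Sc /cone_perpP nP.
have [i ei] : exists i, e i chi != 0.
  by apply/not_existsP => h; apply: nP => i; have /negP := h i;
    rewrite negbK => /eqP.
by rewrite /monomial (bigD1 i) //= exp0rz (negPf ei) !mul0r.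
Qed.

Lemma monomial_poly (z : 'I_r -> {poly C}) w chi : dual_semigroup sigma chi ->
  exists P : {poly C}, forall s, monomial (fun i => (z i).[s]) w chi = P.[s].
Proof.
move=> /cone_dualP Sc.
exists ((\prod_i z i ^+ `|e i chi|%N) * (\prod_k w k ^ f k chi)%:P) => s.
rewrite hornerM hornerC horner_prod; congr (_ * _); apply: eq_bigr => i _.
by rewrite horner_exp; case: (e i chi) (Sc i).
Qed.

End Coordinates.

(** * Polynomial curves in a chart *)

Lemma poly_nonroot (F : numFieldType) (p : {poly F}) :
  p != 0 -> exists2 s, s != 0 & p.[s] != 0.
Proof.
(* The factor ['X] makes 0 a root, so that any nonroot is nonzero. If there were none, the integers
   below the size of the polynomial would be too many distinct roots. *)
move=> p0; have q0 : p * 'X != 0 by rewrite mulf_neq0 // polyX_eq0.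
apply: contrapT => h; have all_root s : root (p * 'X) s.
  rewrite rootM rootX orbC; have [//|s0] := eqVneq s 0.
  by apply: contrapT => /negP ps; apply: h; exists s.
have := @max_poly_roots _ _ [seq i%:R | i <- iota 0 (size (p * 'X))] q0.
rewrite size_map size_iota ltnn map_inj_uniq ?iota_uniq; last first.
  by move=> i j /eqP; rewrite eqr_nat => /eqP.
by move=> H; suff : false by []; apply: H => //; apply/allP => s _.
Qed.

Section Curve.
Variables (R : realType) (X : zmodType).

(** A basic open neighbourhood of [c 0] is given by a function which becomes, along the curve, a
    polynomial in [s] that is nonzero at 0. *)
Lemma chart_curve (sigma : set (Vspace R X)) (W : set (chart_space sigma))
    (c : R[i] -> chart sigma) :
  open W -> W (c 0) ->
  (forall chi, dual_semigroup sigma chi ->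
    exists P : {poly R[i]}, forall s, c s chi = P.[s]) ->
  exists2 s, s != 0 & W (c s).
Proof.
move=> oW W0 cP; have [_ [[n [d [chi [Schi ->]]]] a0 aW]] := (oW : zariski_open
  W) _ W0.
have [P PE] := choice (fun k => cP _ (Schi k)).
have QE s : \sum_k d k * c s (chi k) = (\sum_k d k *: P k).[s].
  by rewrite horner_sum; apply: eq_bigr => k _; rewrite hornerZ PE.
have [|s s0 Qs] := @poly_nonroot _ (\sum_k d k *: P k).
  by apply: contra_neq a0; rewrite QE => ->; rewrite horner0.
by exists s => //; apply: aW; rewrite QE.
Qed.

End Curve.

(** * Smoothness: a chart as a principal open subset of an affine space *)

Section FunAlgebra.
Variables (K : fieldType) (P : Type) (A : fun_algebra K P).

Lemma algfun_sum (I : Type) (s : seq I) (F : I -> P -> K) :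
  (forall i, A (F i)) -> A (fun p => \sum_(i <- s) F i p).
Proof.
move=> AF; elim: s => [|i s IHs].
  by under eq_fun do rewrite big_nil; exact: algfun_cst.
by under eq_fun do rewrite big_cons; exact: algfunD.
Qed.

Lemma algfun_prod (I : Type) (s : seq I) (F : I -> P -> K) :
  (forall i, A (F i)) -> A (fun p => \prod_(i <- s) F i p).
Proof.
move=> AF; elim: s => [|i s IHs].
  by under eq_fun do rewrite big_nil; exact: algfun_cst.
by under eq_fun do rewrite big_cons; exact: algfunM.
Qed.

Lemma algfun_exp (F : P -> K) n : A F -> A (fun p => F p ^+ n).
Proof.
move=> AF; elim: n => [|n IHn].
  by under eq_fun do rewrite expr0; exact: algfun_cst.
by under eq_fun do rewrite exprS; exact: algfunM.
Qed.

End FunAlgebra.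

Lemma zariski_morphism (K : fieldType) (P Q : choiceType) (A : fun_algebra K P)
    (B : fun_algebra K Q) (f : P -> Q) : (forall b, B b -> A (b \o f)) ->
  @fs_morphism _ (zariski_space A) (zariski_space B) f.
Proof.
move=> fAB; split.
  apply/continuousP => W oW.
  suff : zariski_open (A := A) (f @^-1` W) by [].
  move=> p /(oW : zariski_open W)[b [Bb bp bW]].
  by exists (b \o f); split=> //; [exact: fAB|move=> q; exact: bW].
move=> W g oW rg p /rg[a [b [Ba Bb bp gab]]].
by exists (a \o f), (b \o f); split=> //; [exact: fAB|exact: fAB|move=> q;
  exact: gab].
Qed.

Lemma poly_algebra_coord (K : fieldType) N (i : 'I_N) :
  poly_algebra K N (fun v : 'rV[K]_N => v 0 i).
Proof. by exists (mpolyX K (mnm1 i)); apply/funext => v; rewrite mevalXU. Qed.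

Section SmoothChart.
Variables (R : realType) (X : zmodType).
Local Notation V := (Vspace R X).
Local Notation C := R[i].
Variables (r : nat) (e : 'I_r -> cochar X) (J : finType).
Variables (x : 'I_r -> X) (y : J -> X) (f : J -> cochar X).
Hypothesis adapted : adapted_basis e x y f.
Let sigma : set V := cone (fun i => cochar_vec R (e i)).
Let N := (r + #|{: J}|)%N.
Let zc (v : 'rV[C]_N) i := v 0 (lshift #|{: J}| i).
Let wc (v : 'rV[C]_N) k := v 0 (rshift r (enum_rank k)).
Let hc v := \prod_k wc v k.

Let hcE v : (hc v != 0) <-> forall k, wc v k != 0.
Proof. by rewrite /hc; split=> [/prodf_neq0|H]; [move=> H k;
  exact: H|apply/prodf_neq0]. Qed.

Let zc_alg i : poly_algebra C N (zc ^~ i).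
Proof. exact: poly_algebra_coord. Qed.

Let wc_alg k : poly_algebra C N (wc ^~ k).
Proof. exact: poly_algebra_coord. Qed.

Let hc_alg : poly_algebra C N hc.
Proof. exact: algfun_prod. Qed.

(** Only the invertible coordinates carry negative exponents, and a power of their product [hc]
    clears them. The bound leaves [n] free, so that the terms of a sum can share one power. *)
Lemma monomial_clear chi : dual_semigroup sigma chi -> exists N0, forall n,
  (N0 <= n)%N -> exists2 q, poly_algebra C N q & forall v, hc v != 0 ->
    q v = hc v ^+ n * monomial e f (zc v) (wc v) chi.
Proof.
move=> /cone_dualP Sc; exists (\sum_k `|f k chi|)%N => n Nn.
exists (fun v => (\prod_i zc v i ^+ `|e i chi|%N) *
                 \prod_k wc v k ^+ absz (f k chi + n%:Z)%R).
  by apply: algfunM; apply: algfun_prod => i; apply: algfun_exp.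
move=> v /hcE w0; rewrite /monomial /hc -prodrXl mulrCA -big_split /=.
congr (_ * _); apply: eq_bigr => i _; first by case: (e i chi) (Sc i).
rewrite !exprnP -expfzDr // [_ + f i chi]addrC gez0_abs // -lerBlDl sub0r.
apply: (@le_trans _ _ (`|f i chi|%N%:Z));
  first by rewrite abszE -normrN ler_norm.
by rewrite lez_nat (leq_trans _ Nn) // (bigD1 i) //= leq_addr.
Qed.

Lemma chart_fun_clear a : chart_algebra sigma a -> exists n q,
  poly_algebra C N q /\ forall v (p : chart sigma), hc v != 0 ->
    (forall chi, dual_semigroup sigma chi ->
      p chi = monomial e f (zc v) (wc v) chi) ->
    q v = hc v ^+ n * a p.
Proof.
move=> [m [c [chi [Schi ->]]]].
have [M HM] := choice (fun k => monomial_clear (Schi k)).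
pose n := (\sum_k M k)%N.
have Mn k : (M k <= n)%N by rewrite /n (bigD1 k) //= leq_addr.
have q_ k : exists q, poly_algebra C N q /\ forall v, hc v != 0 ->
    q v = hc v ^+ n * monomial e f (zc v) (wc v) (chi k).
  by have [q Aq qE] := HM k n (Mn k); exists q.
have [q qP] := choice q_.
exists n, (fun v => \sum_k c k * q k v); split.
  apply: algfun_sum => k; apply: algfunM; first exact: algfun_cst.
  exact: (qP k).1.
move=> v p hv pE; rewrite mulr_sumr; apply: eq_bigr => k _.
by rewrite (qP k).2 // pE // mulrCA.
Qed.

(** The coordinates [x i] and [y k] identify the chart with the complement of the zero set of [hc];
    monomials give the inverse. There are no equations, whence the index type ['I_0] in the shape
    expected by [smooth_variety]. *)
Lemma smooth_chart_iso : exists (h : mpoly N C),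
  let Z : set (affine_space C N) :=
    [set v | (forall i : 'I_0, meval (fun i => v 0 i) (0 : mpoly N C) = 0) /\
             meval (fun i => v 0 i) h != 0] in
  exists F : chart_space sigma -> fs_sub Z, fs_iso F.
Proof.
have [h hE] := hc_alg; exists h => Z.
have hv (v : 'rV[C]_N) : meval (fun i => v 0 i) h = hc v by rewrite hE.
pose row (p : chart sigma) : 'rV[C]_N := \row_i
  match fintype.split i with inl j => p (x j) | inr k => p (y (enum_val k)) end.
have zrow p i : zc (row p) i = p (x i).
  by rewrite /zc mxE (unsplitK (inl i)).
have wrow p k : wc (row p) k = p (y k).
  by rewrite /wc mxE (unsplitK (inr _)) enum_rankK.
have Zrow p : Z (row p).
  split; first by case.
  by rewrite hv; apply/hcE => k; rewrite wrow (chart_y_neq0 adapted).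
have G_ (v : fs_sub Z) : exists p : chart sigma, forall chi,
    dual_semigroup sigma chi ->
    p chi = monomial e f (zc (set_val v)) (wc (set_val v)) chi.
  by apply: chart_monomial_mk; apply/hcE; rewrite -hv; case: (set_valP v).
have [G GE] := choice G_.
have hcv (v : fs_sub Z) : hc (set_val v) != 0 by rewrite -hv;
  case: (set_valP v).
exists (fun p => in_sub (Zrow p)), G; split.
- move=> p; apply: chart_ext => chi S; rewrite GE //= (chart_monomialE adapted)
  //.
  by rewrite /monomial; congr (_ * _); apply: eq_bigr => i _ /=;
    rewrite ?zrow ?wrow.
- move=> v; apply: val_inj => /=; apply/rowP => i; rewrite mxE.
  case: (fintype.splitP i) => j ij.
    rewrite GE; last exact: (dual_x adapted _).
    by rewrite (monomial_x adapted) /zc; congr (_ 0 _); apply: val_inj.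
  rewrite GE; last exact/perp_dual/(perp_y adapted _).
  by rewrite (monomial_y adapted) /wc enum_valK; congr (_ 0 _); apply: val_inj.
- apply: fs_morphism_to_sub; first exact: zariski_local.
  apply: zariski_morphism => b [q ->].
  rewrite (_ : _ \o _ = fun p : chart sigma =>
     \sum_(m <- msupp q) mcoeff m q * \prod_i (row p) 0 i ^+ fun_of_multinom m
       i) //.
  apply: algfun_sum => m; apply: algfunM; first exact: algfun_cst.
  apply: algfun_prod => i; apply: algfun_exp; under eq_fun do rewrite mxE.
  case: (fintype.split i) => j; apply: mono_algfun;
    first exact: (dual_x adapted _).
  exact/perp_dual/(perp_y adapted _).
apply: fs_morphism_from_sub => [W oW v Wv|W g oW rg v Wv].
  have [a [Aa av aW]] := (oW : zariski_open W) _ Wv.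
  have [n [q [Aq qE]]] := chart_fun_clear Aa.
  have qv (u : fs_sub Z) : q (set_val u) = hc (set_val u) ^+ n * a (G u).
    by apply: qE => // chi; exact: GE.
  exists [set u | q u != 0].
    split; last by rewrite /= qv mulf_neq0 // expf_neq0.
    suff : zariski_open (A := poly_algebra C N) [set u | q u != 0] by [].
    by move=> u qu; exists q.
  by move=> u /=; rewrite qv mulf_eq0 negb_or => /andP[_ /aW].
have [a [b [Aa Ab bv gab]]] := rg _ Wv.
have [na [qa [Aqa qaE]]] := chart_fun_clear Aa.
have [nb [qb [Aqb qbE]]] := chart_fun_clear Ab.
have qav (u : fs_sub Z) : qa (set_val u) = hc (set_val u) ^+ na * a (G u).
  by apply: qaE => // chi; exact: GE.
have qbv (u : fs_sub Z) : qb (set_val u) = hc (set_val u) ^+ nb * b (G u).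
  by apply: qbE => // chi; exact: GE.
(* [a] and [b] were cleared with different powers of [hc]; the crossed factors in the next fraction
   compensate for this, and [hc] must not vanish because it now occurs in the denominator. *)
pose D : set (affine_space C N) := [set u : 'rV[C]_N | qb u * hc u != 0].
exists D, (fun u : 'rV[C]_N => (qa u * hc u ^+ nb) / (qb u * hc u ^+ na));
  split.
- suff : zariski_open (A := poly_algebra C N) D by [].
  move=> u qu; exists (fun u => qb u * hc u); split=> //; exact: algfunM.
- by rewrite /D /= qbv !mulf_neq0 // expf_neq0.
- move=> u Du.
  exists (fun u => qa u * hc u ^+ nb), (fun u => qb u * hc u ^+ na); split=> //.
  + by apply: algfunM => //; apply: algfun_exp.
  + by apply: algfunM => //; apply: algfun_exp.
  + move: Du; rewrite /D /= mulf_eq0 negb_or => /andP[? ?].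
    by rewrite mulf_neq0 // expf_neq0.
move=> u Wu; rewrite /D /= mulf_eq0 negb_or => /andP[+ _].
rewrite qav qbv mulf_eq0 negb_or => /andP[_ bu].
rewrite (mulrAC _ (a _)) (mulrAC _ (b _)) [X in _ / (X * _)]mulrC gab //.
by rewrite -[RHS]mulf_div divff ?mul1r // mulf_neq0 // expf_neq0.
Qed.

End SmoothChart.

Lemma toric_smooth (R : realType) (X : zmodType) (Delta : set (set (Vspace R
    X))) :
  is_lattice X -> smooth_fan Delta -> smooth_variety (toric_variety Delta).
Proof.
move=> latX fanD x0; have [s [p ->]] := toric_pi_surj x0.
exists (range (@toric_pi R X Delta s)); split; last 1 first.
- have [u isou] := toric_pi_iso latX fanD s.
  have [r [e [J [x [y [f [ad sE]]]]]]] := fan_coneP latX fanD (set_valP s).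
  have [h] := smooth_chart_iso R ad; rewrite -sE => -[F isoF].
  exists (r + #|{: J}|)%N, 0%N, (fun=> 0), h; split.
    by move=> v _; apply/eqP; rewrite -leqn0 rank_leq_row.
  by exists (F \o u); exact: fs_iso_comp isou isoF.
- exact: (toric_pi_open latX fanD openT).
- by exists p.
Qed.

(** * Orbits *)

Section Orbits.
Variables (R : realType) (X : zmodType) (Delta : set (set (Vspace R X))).
Hypotheses (latX : is_lattice X) (fanD : smooth_fan Delta).
Local Notation V := (Vspace R X).
Local Notation C := R[i].
Local Notation K := (toric_variety Delta).
Implicit Types (sigma tau rho : set V) (chi psi m : X) (s : set_type Delta)
  (t : torus R X).

Definition closed_orbit_point sigma (p : chart sigma) : Prop :=
  forall chi, dual_semigroup sigma chi -> p chi != 0 -> perp sigma chi.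

Definition closed_orbit s : set K :=
  [set toric_pi p | p in [set p : chart (set_val s) | closed_orbit_point p]].

Lemma torus1 : exists t : torus R X, forall chi, t chi = 1.
Proof.
have D chi psi : (fun _ : X => 1 : C) (chi + psi) = 1 * 1 by rewrite mulr1.
by exists (@Torus R X (fun=> 1) erefl D).
Qed.

Lemma closed_orbit_exists sigma : Delta sigma ->
  exists p : chart sigma, closed_orbit_point p.
Proof.
move=> Ds; have [r [e [J [x [y [f [ad sE]]]]]]] := fan_coneP latX fanD Ds.
subst sigma.
have [p pE] := @chart_monomial_mk R _ _ e J f (fun=> 0) (fun=> 1) (fun=>
  oner_neq0 _).
exists p => chi S; rewrite pE //.
have [//|nP] := pselect (perp (cone (fun i => cochar_vec R (e i))) chi).
by rewrite monomial_z0 // eqxx.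
Qed.

Lemma closed_orbit_trans sigma (p q : chart sigma) : Delta sigma ->
  closed_orbit_point p -> closed_orbit_point q ->
  exists t : torus R X, chart_act t p = q.
Proof.
move=> Ds; have [r [e [J [x [y [f [ad sE]]]]]]] := fan_coneP latX fanD Ds.
subst sigma => op oq.
have p0 k : p (y k) != 0 := chart_y_neq0 ad p k.
have q0 k : q (y k) != 0 := chart_y_neq0 ad q k.
(* Both points vanish at the noninvertible characters, so the action of [t] on the [x i] is
   immaterial and is taken trivial. *)
have [||t tE] := @torus_mk R _ _ e J f (fun=> 1) (fun k => q (y k) / p (y k)).
- by move=> _; rewrite oner_neq0.
- by move=> k; rewrite mulf_neq0 // invr_eq0.
exists t; apply: chart_ext => chi S /=.
have [P|nP] := pselect (perp (cone (fun i => cochar_vec R (e i))) chi);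
  last first.
  have -> : p chi = 0 by apply: contrapT => /eqP/op; auto.
  by rewrite mulr0; symmetry; apply: contrapT => /eqP/oq; auto.
rewrite tE (chart_monomialE ad p) // (chart_monomialE ad q) //.
rewrite (monomial_perp f (p \o x) (fun=> 1)) // (monomial_perp f (q \o x)
  (fun=> 1)) //.
rewrite /monomial !(eq_bigr (fun=> 1) (fun i _ => exp1rz _ _)) !big1_eq !mul1r.
by rewrite -big_split; apply: eq_bigr => k _ /=; rewrite -expfzMl divfK.
Qed.

(* [c] is the orbit of [p] under a one-parameter subgroup in the interior of the
   cone, extended to [z = 0]. *)
Lemma orbit_limit sigma (p : chart sigma) : Delta sigma ->
  exists c : C -> chart sigma,
   [/\ forall chi, dual_semigroup sigma chi ->
         exists P : {poly C}, forall z : C, c z chi = P.[z],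
       closed_orbit_point (c 0) &
       forall z : C, z != 0 -> exists t, c z = chart_act t p].
Proof.
move=> Ds; have [r [e [J [x [y [f [ad sE]]]]]]] := fan_coneP latX fanD Ds.
subst sigma.
have p0 k : p (y k) != 0 := chart_y_neq0 ad p k.
have c_ z := chart_monomial_mk e f (fun i => z * p (x i)) p0.
have [c cE] := choice c_.
exists c; split.
- move=> chi S.
  have [P PE] := monomial_poly f (fun i => p (x i) *: 'X) (p \o y) S.
  exists P => s; rewrite cE // -PE; congr (_ * _).
  by apply: eq_bigr => i _; rewrite hornerZ hornerX mulrC.
- move=> chi S.
  have [//|nP] := pselect (perp (cone (fun i => cochar_vec R (e i))) chi).
  rewrite cE // (_ : (fun i => 0 * p (x i)) = fun=> 0) ?monomial_z0 ?eqxx //.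
  by apply/funext => i; rewrite mul0r.
- move=> z z0.
have [||t tE] := @torus_mk R _ _ e J f (fun=> z) (fun=> 1) => //.
exists t; apply: chart_ext => chi S; rewrite cE //= tE (chart_monomialE ad p)
  //.
rewrite /monomial mulrACA -!big_split /=; congr (_ * _); apply: eq_bigr => i _.
  move/cone_dualP: S => /(_ i); case: (e i chi) => // n _.
  by rewrite -!exprnP exprMn.
by rewrite exp1rz mul1r.
Qed.

(** A relatively closed orbit contains the limit of [orbit_limit] started at one of its points, so
    it meets [closed_orbit s], on which the torus is transitive. Conversely, the complement of
    [closed_orbit s] in the chart is the union of the open loci where some noninvertible character
    is nonzero. *)
Lemma orbit_coneP s (O : set K) :
  orbit_cone O (set_val s) <-> O = closed_orbit s.
Proof.
split=> [[[x0 OE] Ds OU [F cF FE]]|->].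
  have Ox0 : O x0.
    rewrite OE; have [t tE] := torus1; exists t => //.
    have [s' [p ->]] := toric_pi_surj x0.
    rewrite (toric_act_pi latX fanD); congr toric_pi;
      apply: chart_ext => chi _ /=.
    by rewrite tE mul1r.
  have [p x0E] := affine_openP (OU _ Ox0).
  have OpiE t : O (toric_pi (chart_act t p)).
    by rewrite OE; exists t => //; rewrite x0E (toric_act_pi latX fanD).
  have [c [cP c0 cs]] := orbit_limit p Ds.
  have Oc0 : O (toric_pi (c 0)).
    rewrite FE; split; last exact: affine_open_pi.
    apply: contrapT => nF; pose W : set (chart_space (set_val s)) :=
      @toric_pi R X Delta s @^-1` (~` F).
    have oW : open W by apply: (toric_openP (~` F)).1; exact: closed_openC.
    have [a a0] := chart_curve oW nF cP.
    have [t ->] := cs a a0.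
    by rewrite /W /=; apply; have := OpiE t; rewrite FE => -[].
  have [t _ tE] : [set toric_act t x0 | t in setT] (toric_pi (c 0)).
    by rewrite -OE.
  have {}tE : chart_act t p = c 0.
    by apply: (toric_pi_inj latX fanD); rewrite -(toric_act_pi latX fanD) -x0E.
  have pO : closed_orbit_point p.
    move=> chi S pchi; apply: c0 => //; rewrite -tE /= mulf_neq0 //.
    exact: torus_neq0.
  rewrite OE; apply/seteqP; split=> [_ [u _ <-]|_ [q oq <-]].
    rewrite x0E (toric_act_pi latX fanD); exists (chart_act u p) => // chi S.
    by rewrite /= mulf_eq0 negb_or => /andP[_]; exact: pO.
  have [u uE] := closed_orbit_trans Ds pO oq.
  by exists u => //; rewrite x0E (toric_act_pi latX fanD) uE.
have Ds : Delta (set_val s) := set_valP s.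
split=> //.
- have [p op] := closed_orbit_exists Ds; exists (toric_pi p).
  apply/seteqP; split=> [_ [q oq <-]|_ [t _ <-]].
    have [u uE] := closed_orbit_trans Ds op oq.
    by exists u => //; rewrite (toric_act_pi latX fanD) uE.
  exists (chart_act t p); last by rewrite (toric_act_pi latX fanD).
  by move=> chi S /=; rewrite mulf_eq0 negb_or => /andP[_]; exact: op.
- by move=> _ [p _ <-]; exact: affine_open_pi.
pose W : set (chart_space (set_val s)) :=
  [set p | exists chi, [/\ dual_semigroup (set_val s) chi,
     ~ perp (set_val s) chi & (p : chart _) chi != 0]].
have oW : open W.
  suff : zariski_open (A := chart_algebra (set_val s)) W by [].
  move=> p [chi [S nP pchi]]; exists (fun q : chart (set_val s) => q chi);
    split=> //.
    exact: mono_algfun.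
  by move=> q qchi; exists chi.
exists (~` (@toric_pi R X Delta s @` W)).
  apply: open_closedC; exact: toric_pi_open.
apply/seteqP; split=> [_ [p op <-]|z [nW /affine_openP[p zp]]].
  split; last exact: affine_open_pi.
  move=> [q [chi [S nP qchi]] /(toric_pi_inj latX fanD) qp].
  by apply: nP; apply: op => //; rewrite -qp.
rewrite {}zp in nW *.
exists p => // chi S pchi; apply: contrapT => nP; apply: nW.
by exists p => //; exists chi.
Qed.

End Orbits.

(** * The closure of the layer *)

Section PropertyE.
Variables (R : realType) (X : zmodType).
Local Notation V := (Vspace R X).

Lemma dual_lin_indep r (e : 'I_r -> cochar X) (x : 'I_r -> X) :
  (forall i j, e i (x j) = (i == j)%:R) ->
  lin_indep (fun i => cochar_vec R (e i) : V).
Proof.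
move=> ex c c0 j.
have : (\sum_i c i *: cochar_vec R (e i) : V) (x j) = 0 by rewrite c0.
rewrite cone_evalE (bigD1 j) //= ex eqxx mulr1 big1 ?addr0 // => i ij.
by rewrite ex (negPf ij) mulr0.
Qed.

Lemma tensorR_mem (S : set X) chi : S chi -> tensorR S (fun v : V => v chi).
Proof.
move=> Sc; exists 1%N, (fun=> chi), (fun=> 1); split=> //.
by apply/funext => v; rewrite big_ord1 scale1r.
Qed.

(* The sum [u] of the basis provided by (E) is nonnegative on every [e j], and
   vanishes only on those killed by [Gamma]; rounding down the coefficients of
   a large multiple of [u] gives an integral [m] with the same property. *)
Lemma property_E_cochar (Gamma : zmodClosed X) r (e : 'I_r -> cochar X) :
  property_E (tensorR [set` Gamma]) (fun i => cochar_vec R (e i)) ->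
  exists2 m, m \in Gamma & forall j, 0 <= e j m /\
    (e j m = 0 -> forall chi, chi \in Gamma -> e j chi = 0).
Proof.
move=> [n [u [[_ UE] u0]]].
have [l [chi [a [Gchi usum]]]] : tensorR [set` Gamma] (\sum_i u i).
  by rewrite UE; exists (fun=> 1); apply: eq_bigr => i _; rewrite scale1r.
pose w j := \sum_i u i (cochar_vec R (e j)).
have wE j : w j = \sum_k a k * (e j (chi k))%:~R.
  by have /(congr1 (fun g => g (cochar_vec R (e j)))) := usum; rewrite fct_sumE.
have w_ge0 j : 0 <= w j by apply: sumr_ge0.
have w0 j : w j = 0 -> forall psi, psi \in Gamma -> e j psi = 0.
  move=> /eqP; rewrite psumr_eq0 // => /allP z psi Gpsi.
  have : tensorR [set` Gamma] (fun v : V => v psi) by exact: tensorR_mem.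
  rewrite UE => -[c cE].
  have /(congr1 (fun g => g (cochar_vec R (e j)))) := cE.
  rewrite fct_sumE big1 => [/eqP|i _].
    by rewrite intr_eq0 => /eqP.
  have /eqP := z i (mem_index_enum _).
  move=> uz; transitivity (c i * u i (cochar_vec R (e j))) => //.
  by rewrite uz mulr0.
pose b j := \sum_k `|(e j (chi k))%:~R : R|.
have b_ge0 j : 0 <= b j by apply: sumr_ge0.
(* Rounding changes the value on [e j] by at most [b j]. The term of index [j] alone makes [M * w j]
   at least [b j + 1], so the rounded value stays positive; a sum is used in place of a maximum. *)
pose M := \sum_(j | w j != 0) (b j + 1) / w j.
pose m := \sum_k chi k *~ Num.floor (M * a k).
have Gm : m \in Gamma by apply: rpred_sum => k _; apply: rpredMz; exact: Gchi.
have em j : w j != 0 -> 0 < e j m.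
  move=> wj; rewrite -(ltr0z R).
  have -> : (e j m)%:~R = \sum_k (e j (chi k))%:~R * (Num.floor (M * a k))%:~R
    :> R.
    rewrite /m raddf_sum_mulz rmorph_sum; apply: eq_bigr => k _ /=.
    by rewrite -intrM mulrzz.
  have Mw : b j + 1 <= M * w j.
    rewrite -ler_pdivrMr ?lt_def ?wj ?w_ge0 //.
    rewrite /M (bigD1 j) //= lerDl sumr_ge0 // => i _.
    by rewrite divr_ge0 ?addr_ge0.
  have : M * w j - b j <=
      \sum_k (e j (chi k))%:~R * (Num.floor (M * a k))%:~R.
    rewrite lerBlDr wE mulr_sumr -big_split /=; apply: ler_sum => k _.
    rewrite -lerBlDl mulrA mulrC -mulrBr.
    apply: le_trans (ler_norm _) _; rewrite normrM ler_piMr //.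
    have /andP[f0] := floor_itv (M * a k); rewrite intrD addrC => /ltW f1.
    by rewrite ger0_norm ?subr_ge0 // lerBlDr.
  by apply: lt_le_trans; rewrite subr_gt0 (lt_le_trans _ Mw) // ltrDl.
exists m => // j; have [wj|wj] := eqVneq (w j) 0.
  by rewrite (w0 _ wj) //; split=> // _; exact: w0.
have := em j wj; split; first exact: ltW.
by move=> ej; rewrite ej ltxx in H.
Qed.

End PropertyE.

Section Layer.
Variables (R : realType) (X : zmodType) (Delta : set (set (Vspace R X))).
Variables (Gamma : zmodClosed X) (phi : X -> R[i]).
Hypotheses (latX : is_lattice X) (fanD : smooth_fan Delta).
Hypothesis splitG : split_summand [set` Gamma].
Hypothesis charphi : is_character_on [set` Gamma] phi.
Local Notation V := (Vspace R X).
Local Notation C := R[i].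
Local Notation K := (toric_variety Delta).
Implicit Types (sigma tau rho : set V) (chi psi m : X) (s : set_type Delta)
  (t : torus R X).
Local Notation VH := (annihilator [set` Gamma] : set V).

Lemma phi_neq0 chi : chi \in Gamma -> phi chi != 0.
Proof.
have [phi0 phiD] := charphi => Gc.
have := oner_neq0 C; rewrite -phi0 -(subrr chi) phiD //=;
  last by rewrite rpredN.
by rewrite mulf_eq0 negb_or => /andP[].
Qed.

(** [phi] is extended to all of [X] by composing it with the projection [a] onto [Gamma] along a
    complement. *)
Lemma layer_nonempty : layer [set` Gamma] phi !=set0.
Proof.
have [g gK] := split_retract splitG; have [phi0 phiD] := charphi.
pose a chi := chi - g (charH_res Gamma chi).
have aG chi : a chi \in Gamma.
  by rewrite -charH_res_eq0 raddfB gK subrr.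
have a0 : phi (a 0) = 1 by rewrite /a (raddf0 (charH_res Gamma)) (raddf0 g)
  subr0.
have aD chi psi : phi (a (chi + psi)) = phi (a chi) * phi (a psi).
  by rewrite -phiD //=; congr phi; rewrite /a (raddfD (charH_res Gamma))
    (raddfD g) opprD addrACA.
exists (Torus a0 aD) => chi /= Gc.
have /eqP : charH_res Gamma chi == 0 by rewrite charH_res_eq0.
by rewrite /a => ->; rewrite raddf0 subr0.
Qed.

Hypothesis propE : layer_property_E [set` Gamma] Delta.

(** A point of the cone where [m] vanishes is a nonnegative combination of generators killed by [m],
    and these are killed by all of [Gamma]. *)
Lemma layer_cut sigma : Delta sigma ->
  exists2 m, m \in Gamma & cuts m (sigma `&` VH) sigma.
Proof.
move=> Ds; have [r [e [J [x [y [f [ad sE]]]]]]] := fan_coneP latX fanD Ds.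
have [ex _ _ _ _] := ad.
have := propE (dual_lin_indep ex); rewrite -sE => /(_ Ds).
move=> /property_E_cochar[m Gm em]; exists m => //.
rewrite sE; split; first by apply/cone_dualP => j; case: (em j).
apply/seteqP; split=> v [sv]; first by move=> /(_ m Gm) vm; split.
move=> /= vm; split=> // chi Gc; case: sv vm => c c0 ->; rewrite !cone_evalE.
move=> /eqP; rewrite psumr_eq0 => [/allP z|i _]; last first.
  by rewrite mulr_ge0 // ler0z; case: (em i).
rewrite big1 // => i _; have := z i (mem_index_enum _).
rewrite mulf_eq0 intr_eq0 => /orP[/eqP ->|/eqP ei]; first by rewrite mul0r.
by rewrite (em i).2 // mulr0.
Qed.

Lemma layer_fan_setI sigma : Delta sigma -> Delta (sigma `&` VH).
Proof.
by move=> Ds; have [m _ cm] := layer_cut Ds; apply: (fan_cuts_mem fanD Ds cm).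
Qed.

Lemma VH_dual sigma chi : sigma `<=` VH -> chi \in Gamma -> dual_semigroup
    sigma chi.
Proof. by move=> sV Gc v /sV /(_ chi Gc) ->. Qed.

(** For a cone inside [VH] every character in [Gamma] is regular on the chart, so that all the
    equations make sense there. *)
Definition layer_locus : set K := [set x | exists s (p : chart (set_val s)),
  [/\ set_val s `<=` VH, forall chi, chi \in Gamma -> p chi = phi chi
    & x = toric_pi p]].

(** In an arbitrary chart only the equations with regular characters can be written, and they
    suffice: that of [m] forces [q m] to be nonzero, so the point extends to the face inside [VH],
    where the other equations follow after adding a multiple of [m]. This makes closedness a
    chartwise statement. *)
Lemma layer_locus_pi s (q : chart (set_val s)) : layer_locus (toric_pi q) <->
  forall chi, chi \in Gamma -> dual_semigroup (set_val s) chi -> q chi = phi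
    chi.
Proof.
split=> [[t [p [tV pphi qp]]] chi Gc S|qphi].
  have [r [qr pr]] := (toric_pi_eqP latX fanD _ _).1 qp.
  by rewrite qr // -pr ?pphi //; exact: VH_dual.
have Ds : Delta (set_val s) := set_valP s.
have [m Gm cm] := layer_cut Ds.
have qm : q m != 0 by rewrite qphi ?phi_neq0 //; exact: cm.1.
have [r rE] := chart_extend latX fanD Ds cm qm.
have Dr := layer_fan_setI Ds.
pose t : set_type Delta := exist (fun y => y \in Delta) _ (mem_set Dr).
exists t, r; split; first by move=> v [].
  move=> chi Gc; have Sc : dual_semigroup (set_val t) chi.
    by apply: VH_dual Gc => v [].
  have [N /(_ N (leqnn N)) SN] := fan_cuts_loc latX fanD Ds cm Sc.
  have [phi0 phiD] := charphi.
  have Gk n : m *+ n \in Gamma by rewrite rpredMn.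
  have phim n : phi (m *+ n) = phi m ^+ n.
    elim: n => [|n IHn]; first by rewrite mulr0n phi0.
    by rewrite mulrS exprS phiD //= ?IHn //; exact: Gk.
  have m0 := phi_neq0 Gm.
  apply: (mulIf (expf_neq0 N m0)).
  rewrite -phim -(phiD _ _ Gc (Gk N)) phim.
  have Gs : chi + m *+ N \in Gamma by rewrite rpredD.
  rewrite -(qphi _ Gs SN).
  rewrite -rE // chartD //; last first.
    by apply: dual_semigroupMn; exact: cuts_dual cm.
  rewrite chartMn; last exact: cuts_dual cm.
  by rewrite (rE _ cm.1) (qphi _ Gm cm.1).
apply/(toric_pi_eqP latX fanD).
have tst : set_val t `<=` set_val s `&` set_val t by move=> v tv; split=> //;
  case: tv.
have [r' r'E] := chart_restrict r tst.
exists r'; split=> chi S.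
  by rewrite r'E ?rE //; exact: sub_dual_semigroup (@subIsetl _ _ _) _ S.
by rewrite r'E //; exact: sub_dual_semigroup (@subIsetr _ _ _) _ S.
Qed.

Lemma layer_locus_closed : closed layer_locus.
Proof.
rewrite -openC; apply/toric_openP => s.
suff : zariski_open (A := chart_algebra (set_val s))
  (@toric_pi R X Delta s @^-1` (~` layer_locus)) by [].
move=> q; rewrite /= => nL.
have [chi [Gc S qchi]] : exists chi, [/\ chi \in Gamma,
    dual_semigroup (set_val s) chi & q chi != phi chi].
  apply: contrapT => h; apply: nL; apply/layer_locus_pi => chi Gc S.
  by apply: contrapT => /eqP qchi; apply: h; exists chi.
exists (fun q : chart (set_val s) => q chi + - phi chi); split.
- exact: (algfunD (mono_algfun S) (algfun_cst (chart_algebra _) (- phi chi))).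
- by rewrite subr_eq0.
by move=> q'; rewrite subr_eq0 => /eqP q'chi /layer_locus_pi/(_ chi Gc S).
Qed.

Lemma layer_closureE : layer_closure Delta [set` Gamma] phi = layer_locus.
Proof.
apply/seteqP; split.
  rewrite [X in _ `<=` X](closure_id _).1; last exact: layer_locus_closed.
  apply: closure_subset => _ [t tphi [s ->]];
    apply/layer_locus_pi => chi Gc S /=.
  by case: asboolP => // _; exact: tphi.
move=> _ [s [p [sV pphi ->]]] B; rewrite nbhsE => -[W [oW Wp] WB].
have Ds : Delta (set_val s) := set_valP s.
have oWs : open (@toric_pi R X Delta s @^-1` W : set (chart_space (set_val s))).
  exact: (toric_openP W).1.
have [r [e [J [x [y [f [ad sE]]]]]]] := fan_coneP latX fanD Ds.
(* Replacing the vanishing coordinates of [p] by [z <> 0] gives points of the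
   layer, since [Gamma] only involves the invertible coordinates. *)
have [c cE] : exists c : C -> chart (set_val s), [/\ c 0 = p,
    forall chi, dual_semigroup (set_val s) chi ->
      exists P : {poly C}, forall z, c z chi = P.[z] &
    forall z, z != 0 -> exists2 t, layer [set` Gamma] phi t &
      c z = chart_of_torus (set_val s) t].
  move: p pphi {Wp oWs}; rewrite /= {Ds} in sV *;
    move: (set_val s) sV sE => S sV SE.
  subst S => p pphi.
  have y0 k : p (y k) != 0 := chart_y_neq0 ad p k.
  pose zz (z : C) i := if p (x i) == 0 then z else p (x i).
  have c_ z := chart_monomial_mk e f (zz z) y0.
  have [c cE] := choice c_; exists c; split.
  - apply: chart_ext => chi Sc; rewrite cE // (chart_monomialE ad p) //.
    congr (_ * _); apply: eq_bigr => i _; rewrite /zz /=; congr (_ ^ _).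
    by case: eqP.
  - move=> chi Sc.
    pose zp i : {poly C} := if p (x i) == 0 then 'X else (p (x i))%:P.
    have [P PE] := monomial_poly f zp (p \o y) Sc.
    exists P => z; rewrite cE // -PE; congr (_ * _); apply: eq_bigr => i _.
    by rewrite /zp /zz; case: ifP => _; rewrite ?hornerX ?hornerC.
  - move=> z z0.
    have zz0 i : zz z i != 0 by rewrite /zz; case: ifPn.
    have [t tE] := torus_mk e f zz0 y0; exists t.
      move=> chi Gc; rewrite tE -pphi // (chart_monomialE ad);
        last exact: VH_dual.
      apply: monomial_perp => v /sV; exact.
    apply: chart_ext => chi Sc; rewrite cE //= tE.
    by case: asboolP.
case: cE => c0 cP ct; rewrite -c0 in Wp.
have [z z0 Wz] := chart_curve oWs Wp cP.
have [t tphi ctE] := ct z z0.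
exists (toric_pi (c z)); split; last exact: WB.
by exists t => //; exists s; rewrite ctE.
Qed.

(** At a common point [m] takes the nonzero value [phi m]; on the closed orbit this forces [m] to
    vanish on the whole cone, which therefore lies in [VH]. *)
Lemma layer_orbit_empty s : ~ set_val s `<=` VH ->
  closed_orbit s `&` layer_locus = set0.
Proof.
move=> nV; apply/seteqP; split=> // _ [[p op <-] /layer_locus_pi pphi];
  apply: nV.
have [m Gm cm] := layer_cut (set_valP s).
have /op : dual_semigroup (set_val s) m := cm.1.
rewrite pphi ?phi_neq0 //; last exact: cm.1.
move=> /(_ isT) mperp v sv; have [_ sVE] := cm.
by have [] : (set_val s `&` VH) v by rewrite sVE; split=> //; exact: mperp.
Qed.

End Layer.

(** * The fan of the subtorus *)

Section SubtorusFan.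
Variables (R : realType) (X : zmodType) (Gamma : zmodClosed X).
Local Notation V := (Vspace R X).
Local Notation XH := (charH Gamma).
Local Notation res := (charH_res Gamma).
Local Notation VH := (annihilator [set` Gamma] : set V).
Implicit Types (sigma tau : set V) (chi psi m : X).

Lemma charH_resK (c : XH) : res (repr c) = c.
Proof. exact: reprK. Qed.

Lemma res_surj (c : XH) : exists chi, res chi = c.
Proof. by exists (repr c); exact: charH_resK. Qed.

Lemma res_eq chi psi : res chi = res psi -> chi - psi \in Gamma.
Proof. by move=> h; rewrite -charH_res_eq0 (raddfB res) h subrr. Qed.

Lemma hom_descend (W : zmodType) (g : homZ X W) :
  (forall chi, chi \in Gamma -> g chi = 0) ->
  exists h : homZ XH W, forall chi, h (res chi) = g chi.
Proof.
move=> gG.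
have gr c chi : res chi = c -> g (repr c) = g chi.
  move=> cE; apply/eqP; rewrite -subr_eq0 -raddfB; apply/eqP/gG/res_eq.
  by rewrite cE charH_resK.
have hB : zmod_morphism (fun c : XH => g (repr c)).
  move=> c d; rewrite (gr _ (repr c - repr d)) ?raddfB //.
  by rewrite !charH_resK.
by have [h hE] := homZ_mk hB; exists h => chi; rewrite hE; exact: gr.
Qed.

Lemma VH_incl_surj (v : V) : VH v -> exists w : Vspace R XH, VH_incl w = v.
Proof.
move=> vV; have [w wE] := hom_descend (g := v) vV.
by exists w; apply: homZ_ext => chi; exact: wE.
Qed.

Lemma VH_incl_inj : injective (@VH_incl R X Gamma).
Proof.
move=> w w' ww'; apply: homZ_ext => c; have [chi <-] := res_surj c.
exact: (congr1 (fun v : V => v chi) ww').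
Qed.

Lemma coneH_dual sigma chi : sigma `<=` VH ->
  dual_semigroup (coneH Gamma sigma) (res chi) <-> dual_semigroup sigma chi.
Proof.
move=> sV; split=> S v sv; last exact: S _ sv.
have [w wv] := VH_incl_surj (sV v sv).
by rewrite -wv; apply: S; rewrite /coneH /= wv.
Qed.

Lemma coneH_perp sigma chi : sigma `<=` VH ->
  perp (coneH Gamma sigma) (res chi) <-> perp sigma chi.
Proof.
move=> sV; split=> S v sv; last exact: S _ sv.
have [w wv] := VH_incl_surj (sV v sv).
by rewrite -wv; apply: S; rewrite /coneH /= wv.
Qed.

Lemma coneH_cuts m tau sigma :
  cuts m tau sigma -> cuts (res m) (coneH Gamma tau) (coneH Gamma sigma).
Proof. by move=> [S ->]; split=> // w; exact: S. Qed.

(** The generators kill [Gamma], so they descend to cocharacters of [H]. Pullback along [res] is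
    injective and sends these back to the [e i]; the preimage of [B] is then a complement of their
    span. *)
Lemma smooth_coneH sigma : sigma `<=` VH -> smooth_cone sigma ->
  smooth_cone (coneH Gamma sigma).
Proof.
move=> sV [r [e [freee [B [eB eB0]] sE]]]; subst sigma.
have e0 i chi : chi \in Gamma -> e i chi = 0.
  move=> Gc; have /sV/(_ chi Gc)/eqP := cone_gen R e i.
  by rewrite cochar_vecE intr_eq0 => /eqP.
have [eH eHE] := choice (fun i => hom_descend (e0 i)).
exists r, eH; split.
- move=> c c0; apply: freee; apply: homZ_ext => chi; rewrite cone_evalE.
  under eq_bigr do rewrite -eHE.
  by rewrite -cone_evalE c0.
- pose pull (g : cochar XH) : cochar X := (g : {additive _ -> _}) \o res.
  have pullE (g : cochar XH) chi : pull g chi = g (res chi) by [].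
  have [BH BHE] : exists BH : zmodClosed (cochar XH),
      [set` BH] = [set g | pull g \in B].
    apply: zmodClosed_of => /= [|g h gB hB].
      have -> : pull 0 = 0 by apply: homZ_ext.
      exact: rpred0.
    rewrite (_ : pull (g - h) = pull g - pull h) ?rpredB //.
    exact: homZ_ext.
  have inBH g : (g \in BH) <-> pull g \in B.
    by have /seteqP[h h'] := BHE; split=> [/h|/h'].
  have pull_sum (c : 'I_r -> int) :
      pull (\sum_i eH i *~ c i) = \sum_i e i *~ c i.
    apply: homZ_ext => chi; rewrite pullE !homZ_sum; apply: eq_bigr => i _.
    by rewrite !homZ_mulz eHE.
  have pull_inj g : pull g = 0 -> g = 0.
    move=> g0; apply: homZ_ext => c; have [chi <-] := res_surj c.
    by rewrite -pullE g0.
  exists BH; split=> [g|_ [c ->] /inBH]; last first.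
    by rewrite pull_sum => cB; apply: pull_inj; rewrite pull_sum;
      apply: eB0 => //; exists c.
  have [a [b [[c ->] bB gE]]] := eB (pull g).
  exists (\sum_i eH i *~ c i), (g - \sum_i eH i *~ c i); split.
  + by exists c.
  + apply/inBH; rewrite (_ : pull _ = b) //.
    have -> : pull (g - \sum_i eH i *~ c i) = pull g - pull (\sum_i eH i *~ c
      i).
      exact: homZ_ext.
    by rewrite gE pull_sum addrC addKr.
  + by rewrite subrKC.
apply/seteqP; split=> w [a a0 wE]; exists a => //.
  apply: VH_incl_inj; rewrite wE; apply: homZ_ext => chi /=.
  by rewrite [RHS]cone_evalE cone_evalE; apply: eq_bigr => i _; rewrite eHE.
rewrite wE; apply: homZ_ext => chi /=.
by rewrite [LHS]cone_evalE cone_evalE; apply: eq_bigr => i _; rewrite eHE.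
Qed.

Variable Delta : set (set V).
Hypotheses (latX : is_lattice X) (splitG : split_summand [set` Gamma]).
Hypothesis fanD : smooth_fan Delta.

Lemma smooth_fanH : (exists2 sigma, Delta sigma & sigma `<=` VH) ->
  smooth_fan (fanH Gamma Delta).
Proof.
move=> [sigma0 Ds0 sV0]; have [finD _ smD fcD _] := fanD.
have latH := quot_lattice splitG latX.
have smH sigma : Delta sigma -> sigma `<=` VH -> smooth_cone (coneH Gamma
  sigma).
  by move=> Ds sV; apply: smooth_coneH => //; exact: smD.
split.
- apply: finite_image; apply: sub_finite_set finD.
  by move=> sigma [].
- by exists (coneH Gamma sigma0), sigma0.
- by move=> _ [sigma [Ds sV] <-]; exact: smH.
- move=> _ tauH [sigma [Ds sV] <-] fc.
  have [r [e [J [x [y [f [[ex _ _ _ _] sE]]]]]]] := smooth_coneP latH (smH _ Ds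
    sV).
  rewrite sE in fc; have [mH] := cone_face_cuts ex fc; rewrite -sE.
  (* Any lift [m] to [X] of the character cutting the face is nonnegative on [sigma], and the face
     of [sigma] that it cuts induces the given one. *)
  have [m <-] := res_surj mH => -[/coneH_dual-/(_ sV) Sm tauE].
  pose tau := sigma `&` [set v : V | v m = 0].
  exists tau; last by rewrite tauE.
  split; last by move=> v [/sV].
  exact: (fcD _ _ Ds (@cuts_face _ _ m _ _ (conj Sm erefl))).
move=> _ _ [sigma [Ds sV] <-] [tau [Dt tV] <-].
have [m cm] := fan_cuts latX fanD Ds Dt.
have [m' cm'] := fan_cuts latX fanD Dt Ds; rewrite setIC in cm'.
by split; [exact: cuts_face (coneH_cuts cm')|exact: cuts_face (coneH_cuts cm)].
Qed.

End SubtorusFan.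

(** * The isomorphism from the toric variety of the subtorus *)

Lemma toric_morphism_from (R : realType) (X : zmodType)
    (Delta : set (set (Vspace R X))) (Z : funspace R[i])
    (F : toric_variety Delta -> Z) :
  (forall s, @fs_morphism _ (chart_space (set_val s)) Z
     (fun p => F (@toric_pi R X Delta s p))) ->
  fs_morphism F.
Proof.
move=> mF; split=> [|W g oW rg s]; last exact: (mF s).2.
apply/continuousP => W oW; apply/toric_openP => s.
exact: (continuous_open (mF s).1 oW).
Qed.

Section LayerIso.
Variables (R : realType) (X : zmodType) (Delta : set (set (Vspace R X))).
Variables (Gamma : zmodClosed X) (phi : X -> R[i]).
Hypotheses (latX : is_lattice X) (fanD : smooth_fan Delta).
Hypothesis splitG : split_summand [set` Gamma].
Hypothesis charphi : is_character_on [set` Gamma] phi.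
Hypothesis propE : layer_property_E [set` Gamma] Delta.
Local Notation V := (Vspace R X).
Local Notation C := R[i].
Local Notation K := (toric_variety Delta).
Local Notation XH := (charH Gamma).
Local Notation res := (charH_res Gamma).
Local Notation VH := (annihilator [set` Gamma] : set V).
Local Notation DeltaH := (fanH Gamma Delta).
Local Notation KH := (toric_variety DeltaH).
Local Notation L := (@layer_locus R X Delta Gamma phi).
Implicit Types (sigma tau rho : set V) (chi psi m : X) (s : set_type Delta)
  (t : torus R X).

(** (E) supplies the cone of [Delta] inside [VH] needed for nonemptiness: the trace on [VH] of any
    cone. *)
Lemma exists_fanH : smooth_fan DeltaH.
Proof.
apply: smooth_fanH => //; have [_ [sigma Ds] _ _ _] := fanD.
by exists (sigma `&` VH) => [|v []//]; exact: layer_fan_setI.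
Qed.
Let fanDH := exists_fanH.
Let latH := quot_lattice splitG latX.

Variable t0 : torus R X.
Hypothesis t0phi : layer [set` Gamma] phi t0.

(** [sigmaH] is a free parameter because the cone of an index of [DeltaH] is only provably equal to
    some [coneH Gamma sigma]; this avoids transporting points along the equality. *)
Definition lifts sigma sigmaH (p : chart sigma) (p' : chart sigmaH) : Prop :=
  forall chi, dual_semigroup sigma chi -> p chi = t0 chi * p' (res chi).

Lemma lift_exists sigma (p' : chart (coneH Gamma sigma)) : sigma `<=` VH ->
  exists p : chart sigma, lifts p p'.
Proof.
move=> sV; apply: chart_mk.
  by rewrite torus0 (raddf0 res) chart0 mulr1.
move=> chi psi /(coneH_dual _ sV) Sc /(coneH_dual _ sV) Sp.
by rewrite torusD (raddfD res) (chartD p' Sc Sp) mulrACA.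
Qed.

(** On [Gamma] both [p] and [t0] equal [phi], so their quotient is constant on classes modulo
    [Gamma] and descends to characters of [H]. *)
Lemma unlift_exists sigma (p : chart sigma) : sigma `<=` VH ->
  (forall chi, chi \in Gamma -> p chi = phi chi) ->
  exists p' : chart (coneH Gamma sigma), lifts p p'.
Proof.
move=> sV pphi; pose g (c : XH) := p (repr c) / t0 (repr c).
have gE c chi : res chi = c -> dual_semigroup sigma chi -> g c = p chi / t0 chi.
  move=> cE S; have Gd : repr c - chi \in Gamma.
    by apply: res_eq; rewrite charH_resK.
  have rE : repr c = (repr c - chi) + chi by rewrite subrK.
  rewrite /g rE torusD chartD //; last exact: VH_dual Gd.
  by rewrite pphi // t0phi // -mulf_div divff ?mul1r // -t0phi // torus_neq0.
have gres chi : dual_semigroup sigma chi -> g (res chi) = p chi / t0 chi.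
  by move=> S; exact: gE.
have [||p' p'E] := @chart_mk _ _ (coneH Gamma sigma) g.
- by rewrite (gE 0 0) ?chart0 ?torus0 ?divr1 ?(raddf0 res) //;
  exact: dual_semigroup0.
- move=> c d; have [chi <-] := res_surj c; have [psi <-] := res_surj d.
  move=> /(coneH_dual _ sV) Sc /(coneH_dual _ sV) Sp.
  rewrite -(raddfD res) !gres //; last exact: dual_semigroupD.
  by rewrite torusD chartD // mulf_div.
exists p' => chi S; rewrite p'E; last exact/coneH_dual.
by rewrite gres // mulrC divfK // torus_neq0.
Qed.

(* The graph of the isomorphism from the toric variety of [DeltaH] onto the
   closure of the layer. *)
Definition layer_rel (y : KH) (x : K) : Prop :=
  exists (s' : set_type DeltaH) (p' : chart (set_val s')) s
    (p : chart (set_val s)),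
  [/\ set_val s `<=` VH, coneH Gamma (set_val s) = set_val s',
      y = toric_pi p', x = toric_pi p & lifts p p'].

Lemma lifts_layer sigma sigmaH (p : chart sigma) (p' : chart sigmaH) chi :
  sigma `<=` VH -> chi \in Gamma -> lifts p p' -> p chi = phi chi.
Proof.
move=> sV Gc -> //; last exact: VH_dual Gc.
have /eqP -> : res chi == 0 by rewrite charH_res_eq0.
by rewrite chart0 mulr1 t0phi.
Qed.

Lemma fanH_cone (s' : set_type DeltaH) : exists s,
  set_val s `<=` VH /\ coneH Gamma (set_val s) = set_val s'.
Proof.
have [sigma [Ds sV] sE] := set_valP s'.
by exists (exist (fun y => y \in Delta) sigma (mem_set Ds)).
Qed.

Lemma cone_fanH s : set_val s `<=` VH -> exists s' : set_type DeltaH,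
  coneH Gamma (set_val s) = set_val s'.
Proof.
move=> sV; have DH : DeltaH (coneH Gamma (set_val s)).
  by exists (set_val s) => //; split=> //; exact: set_valP.
by exists (exist (fun y => y \in DeltaH) _ (mem_set DH)).
Qed.

Lemma lift_chart (s' : set_type DeltaH) s (p' : chart (set_val s')) :
  set_val s `<=` VH -> coneH Gamma (set_val s) = set_val s' ->
  exists p : chart (set_val s), lifts p p'.
Proof.
by move=> sV sE; move: p'; rewrite -sE => p'; exact: lift_exists.
Qed.

Lemma unlift_chart (s' : set_type DeltaH) s (p : chart (set_val s)) :
  set_val s `<=` VH -> coneH Gamma (set_val s) = set_val s' ->
  (forall chi, chi \in Gamma -> p chi = phi chi) ->
  exists p' : chart (set_val s'), lifts p p'.
Proof. by move=> sV <-; exact: unlift_exists. Qed.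

Lemma layer_rel_total y : exists x, layer_rel y x.
Proof.
have [s' [p' ->]] := toric_pi_surj y; have [s [sV sE]] := fanH_cone s'.
have [p pp] := lift_chart p' sV sE.
by exists (toric_pi p), s', p', s, p.
Qed.

Lemma layer_rel_onto x : L x -> exists y, layer_rel y x.
Proof.
move=> [s [p [sV pphi ->]]]; have [s' sE] := cone_fanH sV.
have [p' pp] := unlift_chart sV sE pphi.
by exists (toric_pi p'), s', p', s, p.
Qed.

Lemma layer_rel_locus y x : layer_rel y x -> L x.
Proof.
move=> [s' [p' [s [p [sV _ _ -> pp]]]]]; exists s, p; split=> // chi Gc.
exact: lifts_layer pp.
Qed.

(** From left to right the graph is single-valued, from right to left it is injective. Both come
    from lifting or descending the common point on the chart of the intersection. *)
Lemma layer_relP y x y' x' : layer_rel y x -> layer_rel y' x' ->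
  y = y' <-> x = x'.
Proof.
move=> [s1' [p1' [s1 [p1 [sV1 sE1 -> -> pp1]]]]].
move=> [s2' [p2' [s2 [p2 [sV2 sE2 -> -> pp2]]]]].
have sV : set_val s1 `&` set_val s2 `<=` VH by move=> v [/sV1].
have sE : coneH Gamma (set_val s1 `&` set_val s2) = set_val s1' `&` set_val s2'.
  by rewrite -sE1 -sE2.
have S1 chi : dual_semigroup (set_val s1) chi -> dual_semigroup (set_val s1')
  (res chi).
  by rewrite -sE1 => S; exact/coneH_dual.
have S2 chi : dual_semigroup (set_val s2) chi -> dual_semigroup (set_val s2')
  (res chi).
  by rewrite -sE2 => S; exact/coneH_dual.
have S12 := sub_dual_semigroup (@subIsetl _ (set_val s1) (set_val s2)).
have S21 := sub_dual_semigroup (@subIsetr _ (set_val s1) (set_val s2)).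
split=> [/(toric_pi_eqP latH fanDH)|/(toric_pi_eqP latX fanD)].
  rewrite -sE => -[r' [pr1 pr2]]; have [r rr] := lift_exists r' sV.
  apply/(toric_pi_eqP latX fanD); exists r; split=> chi S.
    by rewrite pp1 // rr ?pr1; auto.
  by rewrite pp2 // rr ?pr2; auto.
move=> [r [pr1 pr2]].
have [r' rr] : exists r' : chart (coneH Gamma (set_val s1 `&` set_val s2)),
  lifts r r'.
  apply: unlift_exists => // chi Gc.
  rewrite -pr1; last exact: VH_dual Gc.
  exact: lifts_layer pp1.
apply/(toric_pi_eqP latH fanDH); rewrite -sE; exists r'.
split=> c; have [chi <-] := res_surj c => S.
  have {}S : dual_semigroup (set_val s1) chi by apply/(coneH_dual _ sV1);
    rewrite sE1.
  by apply: (mulfI (torus_neq0 t0 chi)); rewrite -pp1 // -rr ?pr1 //;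
    exact: S12.
have {}S : dual_semigroup (set_val s2) chi by apply/(coneH_dual _ sV2);
  rewrite sE2.
by apply: (mulfI (torus_neq0 t0 chi)); rewrite -pp2 // -rr ?pr2 //; exact: S21.
Qed.

(** Restriction of functions to the closed subset is surjective, which is what makes the inverse map
    a morphism; the division by [t0] undoes the translation. *)
Lemma lift_fun sigma sigmaH a : sigma `<=` VH -> coneH Gamma sigma = sigmaH ->
  chart_algebra sigmaH a -> exists2 b, chart_algebra sigma b &
  forall (p : chart sigma) (p' : chart sigmaH), lifts p p' -> b p = a p'.
Proof.
move=> sV sE; subst sigmaH => -[n [c [chi [Schi ->]]]].
have S k : dual_semigroup sigma (repr (chi k)).
  by apply/(coneH_dual _ sV); rewrite charH_resK.
exists (fun p => \sum_k (c k / t0 (repr (chi k))) * p (repr (chi k))).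
  by exists n, (fun k => c k / t0 (repr (chi k))), (fun k => repr (chi k)).
move=> p p' pp; apply: eq_bigr => k _.
by rewrite pp // charH_resK mulrA divfK // torus_neq0.
Qed.

Variable Psi : KH -> fs_sub L.
Hypothesis PsiE : forall y, layer_rel y (set_val (Psi y)).

Lemma layer_rel_Psi y x : layer_rel y x -> set_val (Psi y) = x.
Proof. by move=> yx; apply/(layer_relP (PsiE y) yx). Qed.

Lemma Psi_morphism : fs_morphism Psi.
Proof.
apply: fs_morphism_to_sub; first exact: toric_local.
apply: toric_morphism_from => s'; have [s [sV sE]] := fanH_cone s'.
have [l lE] := choice (fun p' : chart (set_val s') => lift_chart p' sV sE).
have -> : (fun p' => set_val (Psi (@toric_pi _ _ DeltaH s' p'))) =
    (@toric_pi _ _ Delta s) \o l.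
  apply/funext => p'; apply: layer_rel_Psi.
  by exists s', p', s, (l p').
apply: (@fs_morphism_comp _ (chart_space _) (chart_space _)); last first.
  exact: toric_pi_morphism.
apply: zariski_morphism => _ [n [c [chi [Schi ->]]]].
exists n, (fun k => c k * t0 (chi k)), (fun k => res (chi k)); split.
  by move=> k; rewrite -sE; exact/coneH_dual.
by apply/funext => p' /=; apply: eq_bigr => k _; rewrite (lE p') // mulrA.
Qed.

Lemma Psi_inv_morphism (G : fs_sub L -> KH) :
  (forall x, layer_rel (G x) (set_val x)) -> fs_morphism G.
Proof.
move=> GE.
have localize (x : fs_sub L) : exists (s' : set_type DeltaH) s (p' : chart
  (set_val s'))
    (p : chart (set_val s)),
    [/\ set_val s `<=` VH, coneH Gamma (set_val s) = set_val s',
        G x = toric_pi p', set_val x = toric_pi p & lifts p p'].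
  by have [s' [p' [s [p]]]] := GE x; exists s', s, p', p.
(* The charts found at [x] serve for every point of the locus in the chart of [s]: there [G] is
   given by descending the point. *)
have GL s (s' : set_type DeltaH) (y : fs_sub L) (q : chart (set_val s)) :
  set_val s `<=` VH ->
    coneH Gamma (set_val s) = set_val s' -> set_val y = toric_pi q ->
    exists2 q' : chart (set_val s'), G y = toric_pi q' & lifts q q'.
  move=> sV sE yq; have Ly : L (toric_pi q) by rewrite -yq; exact: set_valP.
  have qphi chi : chi \in Gamma -> q chi = phi chi.
    move=> Gc; apply: ((layer_locus_pi latX fanD charphi propE _).1 Ly) => //.
    exact: VH_dual Gc.
  have [q' qq] := unlift_chart sV sE qphi; exists q' => //.
  by apply/(layer_relP (GE y) (x' := toric_pi q)) => //; exists s', q', s, q.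
apply: fs_morphism_from_sub => [W oW x Wx|W g oW rg x Wx].
  have [s' [s [p' [p [sV sE Gx xp pp]]]]] := localize x.
  rewrite Gx in Wx.
  have oW' : open (@toric_pi _ _ DeltaH s' @^-1` W : set (chart_space (set_val
    s'))).
    exact: (toric_openP W).1.
  have [a [Aa ap aW]] := (oW' : zariski_open _) p' Wx.
  have [b Ab bE] := lift_fun sV sE Aa.
  pose D : set (chart_space (set_val s)) := [set q | b q != 0].
  have oD : open D.
    suff : zariski_open (A := chart_algebra (set_val s)) D by [].
    by move=> q bq; exists b.
  exists (@toric_pi _ _ Delta s @` D).
    split; first exact: (toric_pi_open latX fanD).
    by exists p; rewrite // /D /= (bE p p').
  move=> y [q bq yq]; have [q' -> qq] := GL _ _ _ _ sV sE (esym yq).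
  by apply: aW; rewrite -(bE q q').
have [s' [s [p' [p [sV sE Gx xp pp]]]]] := localize x.
rewrite Gx in Wx.
have [a' [b' [Aa' Ab' bp' gE]]] := rg s' p' Wx.
have [a Aa aE] := lift_fun sV sE Aa'; have [b Ab bE] := lift_fun sV sE Ab'.
pose D : set (chart_space (set_val s)) := [set q | b q != 0].
have oD : open D.
  suff : zariski_open (A := chart_algebra (set_val s)) D by [].
  by move=> q bq; exists b.
have h_ (z : K) : exists c : C,
    forall q : chart (set_val s), toric_pi q = z -> c = a q / b q.
  have [[q <-]|nq] := pselect (exists q : chart (set_val s), toric_pi q = z).
    by exists (a q / b q) => q1 /(toric_pi_inj latX fanD) ->.
  by exists 0 => q qz; case: nq; exists q.
have [h hE] := choice h_.
exists (@toric_pi _ _ Delta s @` D), h; split.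
- exact: (toric_pi_open latX fanD).
- by exists p; rewrite // /D /= (bE p p').
- apply: (toric_pi_regular latX fanD (f := fun q => a q / b q)) => //.
    by move=> q bq; exists a, b.
  by move=> q _; exact: hE.
move=> y Wy [q bq yq]; have [q' Gy qq] := GL _ _ _ _ sV sE (esym yq).
rewrite Gy in Wy *; rewrite -yq (hE _ q) // (aE q q') // (bE q q') //.
by rewrite [LHS](gE q') // -(bE q q').
Qed.

Lemma Psi_iso : fs_iso Psi /\ exists G : fs_sub L -> KH, fs_iso G.
Proof.
have G_ (x : fs_sub L) : exists y, layer_rel y (set_val x).
  exact/layer_rel_onto/set_valP.
have [G GE] := choice G_.
have PG : cancel Psi G by move=> y; apply/(layer_relP (GE _) (PsiE y)).
have GP : cancel G Psi.
  by move=> x; apply: val_inj; exact: layer_rel_Psi.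
have mP := Psi_morphism; have mG := Psi_inv_morphism GE.
by split; [exists G|exists G, Psi].
Qed.

Lemma Psi_equivariant (h : torus R XH) y :
  set_val (Psi (toric_act h y)) = toric_act (torusH_incl h) (set_val (Psi y)).
Proof.
apply: layer_rel_Psi; have [s' [p' [s [p [sV sE -> -> pp]]]]] := PsiE y.
rewrite (toric_act_pi latX fanD) (toric_act_pi latH fanDH).
exists s', (chart_act h p'), s, (chart_act (torusH_incl h) p);
  split=> // chi S /=.
by rewrite pp // mulrCA.
Qed.

Lemma Psi_torus (h : torus R XH) y : is_torus_point h y ->
  is_torus_point (torus_mul (torusH_incl h) t0) (set_val (Psi y)).
Proof.
move=> [s' ->]; have [s [sV sE]] := fanH_cone s'; exists s.
apply: layer_rel_Psi; exists s', (chart_of_torus (set_val s') h), s.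
exists (chart_of_torus (set_val s) (torus_mul (torusH_incl h) t0)); split=> //.
move=> chi S /=; case: asboolP => // _; case: asboolP => [_|[]].
  by rewrite mulrC.
by rewrite -sE; exact/coneH_dual.
Qed.

(** The values of [t0] are nonzero, so lifting preserves which characters vanish at a point, and
    [res] preserves which are invertible. *)
Lemma Psi_closed_orbit s (s' : set_type DeltaH) : set_val s `<=` VH ->
  coneH Gamma (set_val s) = set_val s' ->
  closed_orbit s `&` L = [set set_val (Psi y) | y in closed_orbit s'].
Proof.
move=> sV sE; have lE : forall (p : chart (set_val s)) (p' : chart (set_val
  s')),
    lifts p p' -> closed_orbit_point p <-> closed_orbit_point p'.
  move=> p p' pp; split=> op.
    move=> c; have [chi <-] := res_surj c => S' pc; rewrite -sE.
    have S : dual_semigroup (set_val s) chi by apply/(coneH_dual _ sV);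
      rewrite sE.
    apply/(coneH_perp _ sV); apply: op => //.
    by rewrite pp // mulf_neq0 // torus_neq0.
  move=> chi S; rewrite pp // mulf_eq0 negb_or => /andP[_ pc].
  apply/(coneH_perp _ sV); rewrite sE; apply: op => //.
  by rewrite -sE; exact/coneH_dual.
apply/seteqP; split=> [x [[p op px] Lx]|_ [y [p' op' <-] <-]].
  subst x.
  have pphi chi : chi \in Gamma -> p chi = phi chi.
    move=> Gc; apply: ((layer_locus_pi latX fanD charphi propE _).1 Lx) => //.
    exact: VH_dual Gc.
  have [p' pp] := unlift_chart sV sE pphi.
  exists (toric_pi p'); first by exists p' => //; exact/(lE p p' pp).
  by apply: layer_rel_Psi; exists s', p', s, p.
have [p pp] := lift_chart p' sV sE.
have rel : layer_rel (toric_pi p') (toric_pi p) by exists s', p', s, p.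
rewrite (layer_rel_Psi rel); split; last exact: layer_rel_locus rel.
by exists p => //; exact/(lE p p' pp).
Qed.

End LayerIso.

Theorem theorem3p1 (R : realType) (X : zmodType)
    (Delta : set (set (Vspace R X))) (Gamma : zmodClosed X) (phi : X -> R[i]) :
  is_lattice X ->
  smooth_fan Delta ->
  split_summand [set` Gamma] ->
  is_character_on [set` Gamma] phi ->
  layer_property_E [set` Gamma] Delta ->
  let VH : set (Vspace R X) := annihilator [set` Gamma] in
  let DeltaH := fanH Gamma Delta in
  let Kbar := layer_closure Delta [set` Gamma] phi in
  [/\ layer [set` Gamma] phi !=set0,
      smooth_fan DeltaH,
      smooth_variety (fs_sub Kbar),
      forall (O : set (toric_variety Delta)) (sigma : set (Vspace R X)),
        orbit_cone O sigma -> ~ sigma `<=` VH -> O `&` Kbar = set0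
    & forall t0 : torus R X, layer [set` Gamma] phi t0 ->
      exists Psi : toric_variety DeltaH -> fs_sub Kbar,
        [/\ fs_iso Psi,
            forall (h : torus R (charH Gamma)) (y : toric_variety DeltaH),
              set_val (Psi (toric_act h y)) =
              toric_act (torusH_incl h) (set_val (Psi y)),
            forall (h : torus R (charH Gamma)) (y : toric_variety DeltaH),
              is_torus_point h y ->
              is_torus_point (torus_mul (torusH_incl h) t0) (set_val (Psi y))
          & forall (O : set (toric_variety Delta)) (sigma : set (Vspace R X)),
              orbit_cone O sigma -> sigma `<=` VH ->
              exists2 O' : set (toric_variety DeltaH),
                orbit_cone O' (coneH Gamma sigma)
                & O `&` Kbar = [set set_val (Psi y) | y in O']]].
Proof.
move=> latX fanD splitG charphi propE VH DeltaH Kbar.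
have KbarE : Kbar = @layer_locus R X Delta Gamma phi by exact: layer_closureE.
rewrite {}KbarE.
have latH := quot_lattice splitG latX.
have fanDH : smooth_fan DeltaH by exact: exists_fanH.
have Psi_ t0 : layer [set` Gamma] phi t0 ->
    exists Psi : toric_variety DeltaH ->
      fs_sub (@layer_locus R X Delta Gamma phi),
    forall y, layer_rel t0 y (set_val (Psi y)).
  move=> t0phi; have rt (y : toric_variety DeltaH) : exists x, layer_rel t0 y x.
    exact: layer_rel_total.
  have [F FE] := choice rt.
  by exists (fun y => in_sub (layer_rel_locus t0phi (FE y))) => y; exact: FE.
have orbit_set_type O sigma : @orbit_cone R X Delta O sigma ->
    exists2 s : set_type Delta, set_val s = sigma & O = closed_orbit s.
  move=> oc; have [_ Ds _ _] := oc.
  exists (exist (fun y => y \in Delta) sigma (mem_set Ds)) => //.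
  exact/orbit_coneP.
have [t1 t1phi] := layer_nonempty splitG charphi.
split=> //.
- by exists t1.
(* Smoothness does not refer to a base point, so the isomorphism for one point [t1] of the layer
   transfers it from the toric variety of [DeltaH]. *)
- have [Psi PsiE] := Psi_ t1 t1phi.
  have [_ [G isoG]] := Psi_iso latX fanD splitG charphi propE t1phi PsiE.
  apply: fs_iso_smooth isoG _; [|exact: toric_local|exact: toric_smooth].
  exact/fs_sub_local/toric_local.
- by move=> O sigma /orbit_set_type[s <- ->] nV; exact: layer_orbit_empty.
move=> t0 t0phi; have [Psi PsiE] := Psi_ t0 t0phi; exists Psi; split.
- by have [] := Psi_iso latX fanD splitG charphi propE t0phi PsiE.
- exact: Psi_equivariant PsiE.
- exact: Psi_torus PsiE.
move=> O sigma /orbit_set_type[s <- ->] sV.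
have [s' sE] := cone_fanH sV.
exists (closed_orbit s'); first by rewrite sE; exact/orbit_coneP.
exact: (Psi_closed_orbit latX fanD splitG charphi propE t0phi PsiE sV sE).
Qed.
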